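(* Over $\Bbbk=\mathbb C(q)$, the $\mathbb C(q)$-linear monoidal categories $\mathbf{Web}^{\bullet\prime}$ and $\mathbf{Web}^\bullet$ are isomorphic by matching the generating objects and generating morphisms with the same symbols: there is an isomorphism of strict $\mathbb C(q)$-linear monoidal categories $\mathbf{Web}^{\bullet\prime}\to\mathbf{Web}^\bullet$ with $a\mapsto a$, $\mathsf m_{a,b}\mapsto\mathsf m_{a,b}$, $\mathsf s_{a,b}\mapsto\mathsf s_{a,b}$, $\mathsf c_{a,b}\mapsto\mathsf c_{a,b}$, and $\mathsf x_a\mapsto\mathsf x_a$ for all $a,b\ge1$, where $\mathsf x_a$ for $a\ge 2$ is defined in $\mathbf{Web}^{\bullet\prime}$ by $\mathsf x_a=\frac1{[a]!}\mathsf m_{1^a}\mathsf x_1^{\otimes a}\mathsf s_{1^a}$ (and the element $\frac1{[a]!}\mathsf m_{1^a}(\mathsf x_1^{-1})^{\otimes a}\mathsf s_{1^a}$ is sent to $\mathsf x_a^{-1}$).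
   Context: **Notation.** $[n]=\frac{q^n-q^{-n}}{q-q^{-1}}$, $[a]!=[1][2]\cdots[a]$, $\begin{bmatrix}n\\ a\end{bmatrix}=\frac{[n][n-1]\cdots[n-a+1]}{[a]!}$. In a strict monoidal category, $fg=f\circ g$, $\otimes$ is horizontal juxtaposition. Strands of thickness $0$ are deleted: $0$ is the unit object, and merges, splits, crossings and dots involving a $0$ are identities. Iterated merges and splits (well defined by (W1)) are $\mathsf m_{a_1,\dots,a_k}$, $\mathsf s_{a_1,\dots,a_k}$; $1^a=(1,\dots,1)$ ($a$ ones). **$\mathbf{Web}^\bullet$** (over $\mathbb C(q)$) is the strict $\mathbb C(q)$-linear monoidal category with generating objects $a\in\mathbb Z_{\ge1}$ and generating morphisms $\mathsf m_{a,b}:a\otimes b\to a+b$, $\mathsf s_{a,b}:a+b\to a\otimes b$, $\mathsf c_{a,b}:a\otimes b\to b\otimes a$, $\mathsf x_a:a\to a$, with $\mathsf c_{a,b}$ and $\mathsf x_a$ invertible, subject to, for all $a,b,c,d\ge1$: (W1) $\mathsf m_{a+b,c}(\mathsf m_{a,b}\otimes1_c)=\mathsf m_{a,b+c}(1_a\otimes\mathsf m_{b,c})$, $(\mathsf s_{a,b}\otimes1_c)\mathsf s_{a+b,c}=(1_a\otimes\mathsf s_{b,c})\mathsf s_{a,b+c}$; (W2) if $a+c=b+d$: $\mathsf s_{b,d}\mathsf m_{a,c}=\sum q^{st}(\mathsf m_{s,b-s}\otimes\mathsf m_{a-s,t})(1_s\otimes\mathsf c_{a-s,c-t}\otimes1_t)(\mathsf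 s_{s,a-s}\otimes\mathsf s_{c-t,t})$, over $0\le s\le\min(a,b)$, $0\le t\le\min(c,d)$, $t-s=d-a$; (W3) $\mathsf m_{a,b}\mathsf s_{a,b}=\begin{bmatrix}a+b\\ a\end{bmatrix}1_{a+b}$; (W4) $\mathsf c_{a,b}(\mathsf x_a\otimes1_b)=(1_b\otimes\mathsf x_a)\mathsf c_{b,a}^{-1}$, $(\mathsf x_b\otimes1_a)\mathsf c_{a,b}=\mathsf c_{b,a}^{-1}(1_a\otimes\mathsf x_b)$; (W5) $\mathsf s_{a,b}\mathsf x_{a+b}=(\mathsf x_a\otimes\mathsf x_b)\mathsf s_{a,b}$, $\mathsf x_{a+b}\mathsf m_{a,b}=\mathsf m_{a,b}(\mathsf x_a\otimes\mathsf x_b)$; (W6) $\mathsf m_{1^a}\,\mathsf x_1^{\otimes a}\,\mathsf s_{1^a}=[a]!\,\mathsf x_a$, $\mathsf m_{1^a}(\mathsf x_1^{-1})^{\otimes a}\mathsf s_{1^a}=[a]!\,\mathsf x_a^{-1}$. **$\mathbf{Web}^{\bullet\prime}$** is the strict $\mathbb C(q)$-linear monoidal category with generating objects $a\in\mathbb Z_{\ge1}$, generating morphisms $\mathsf m_{a,b},\mathsf s_{a,b},\mathsf c_{a,b}$ ($a,b\ge1$) and $\mathsf x_1:1\to1$, with $\mathsf c_{a,b}$ and $\mathsf x_1$ invertible, subject to (W1), (W2), (W3), and (W4) only for $a=b=1$. *)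

(* Defs.v *)
From HB Require Import structures.
From mathcomp Require Import all_boot all_order all_algebra.
From mathcomp Require Import generic_quotient fraction zify.
From mathcomp Require Import complex.
From mathcomp Require Import boolp reals.

Set Implicit Arguments.
Unset Strict Implicit.
Unset Printing Implicit Defensive.

Import GRing.Theory.
Local Open Scope ring_scope.
Local Open Scope quotient_scope.

Declare Scope smc_scope.
Delimit Scope smc_scope with smc.
Reserved Notation "f ∘ g" (at level 50, left associativity).
Reserved Notation "f ⊗ g" (at level 40, left associativity).

(* Equality of morphisms whose domains and codomains are only propositionally
   equal; [heq f g] entails that these coincide. *)
Inductive heq (k : fieldType) (O : Type) (H : O -> O -> lmodType k)
    (a b : O) (f : H a b) : forall a' b', H a' b' -> Prop :=
  heq_refl : heq f f.
Arguments heq {k O H a b} f {a' b'} g.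

Record smcat (k : fieldType) := SMCat {
  ob :> Type;
  hom : ob -> ob -> lmodType k;
  idm : forall a, hom a a;
  comp : forall a b c, hom b c -> hom a b -> hom a c;
  unit_ob : ob;
  tens_ob : ob -> ob -> ob;
  tens : forall a b c d,
    hom a b -> hom c d -> hom (tens_ob a c) (tens_ob b d);
  comp1m : forall a b (f : hom a b), comp (idm b) f = f;
  compm1 : forall a b (f : hom a b), comp f (idm a) = f;
  compA : forall a b c d (f : hom c d) (g : hom b c) (h : hom a b),
    comp (comp f g) h = comp f (comp g h);
  comp_linl : forall a b c (z : k) (f f' : hom b c) (g : hom a b),
    comp (z *: f + f') g = z *: comp f g + comp f' g;
  comp_linr : forall a b c (z : k) (f : hom b c) (g g' : hom a b),
    comp f (z *: g + g') = z *: comp f g + comp f g';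
  tens_linl : forall a b c d (z : k) (f f' : hom a b) (g : hom c d),
    tens (z *: f + f') g = z *: tens f g + tens f' g;
  tens_linr : forall a b c d (z : k) (f : hom a b) (g g' : hom c d),
    tens f (z *: g + g') = z *: tens f g + tens f g';
  tens_idm : forall a c, tens (idm a) (idm c) = idm (tens_ob a c);
  tens_comp : forall a b c a' b' c' (f : hom b c) (g : hom a b)
      (f' : hom b' c') (g' : hom a' b'),
    comp (tens f f') (tens g g') = tens (comp f g) (comp f' g');
  tens_obA : forall a b c,
    tens_ob (tens_ob a b) c = tens_ob a (tens_ob b c);
  tens_ob1l : forall a, tens_ob unit_ob a = a;
  tens_ob1r : forall a, tens_ob a unit_ob = a;
  tensA : forall a b c a' b' c' (f : hom a a') (g : hom b b') (h : hom c c'),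
    heq (tens (tens f g) h) (tens f (tens g h));
  tens1m : forall a b (f : hom a b), heq (tens (idm unit_ob) f) f;
  tensm1 : forall a b (f : hom a b), heq (tens f (idm unit_ob)) f
}.
Arguments hom {k} s _ _.
Arguments unit_ob {k} s.

Record smfunctor (k : fieldType) (C D : smcat k) := SMFunctor {
  fob :> C -> D;
  fmap : forall a b, hom C a b -> hom D (fob a) (fob b);
  fmap_lin : forall a b (z : k) (f g : hom C a b),
    fmap (z *: f + g) = z *: fmap f + fmap g;
  fmap_id : forall a, fmap (idm a) = idm (fob a);
  fmap_comp : forall a b c (f : hom C b c) (g : hom C a b),
    fmap (comp f g) = comp (fmap f) (fmap g);
  fob_unit : fob (unit_ob C) = unit_ob D;
  fob_tens : forall a b, fob (tens_ob a b) = tens_ob (fob a) (fob b);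
  fmap_tens : forall a b c d (f : hom C a b) (g : hom C c d),
    heq (fmap (tens f g)) (tens (fmap f) (fmap g))
}.
Arguments fmap {k C D} s {a b}.

Definition inverse_functors (k : fieldType) (C D : smcat k)
    (F : smfunctor C D) (G : smfunctor D C) : Prop :=
  [/\ forall a : C, G (F a) = a,
      forall (a b : C) (f : hom C a b), heq (fmap G (fmap F f)) f,
      forall a : D, F (G a) = a &
      forall (a b : D) (f : hom D a b), heq (fmap F (fmap G f)) f].

Definition is_smiso (k : fieldType) (C D : smcat k) (F : smfunctor C D) :=
  exists G : smfunctor D C, inverse_functors F G.

Record signature := Signature {
  gob : eqType;
  gmor : Type;
  gsrc : gmor -> seq gob;
  gtgt : gmor -> seq gob
}.

Inductive term (k : Type) (S : signature) : Type :=
| Gen of gmor S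
| Id of seq (gob S)
| Comp of term k S & term k S
| Tens of term k S & term k S
| Zero of seq (gob S) & seq (gob S)
| Add of term k S & term k S
| Scale of k & term k S.
Arguments Gen {k S} _.
Arguments Id {k S} _.
Arguments Zero {k S} _ _.

Notation "f ∘ g" := (Comp f g) : smc_scope.
Notation "f ⊗ g" := (Tens f g) : smc_scope.

HB.instance Definition _ k S := gen_eqMixin (term k S).
HB.instance Definition _ k S := gen_choiceMixin (term k S).

Section Presentation.
Variables (k : fieldType) (S : signature).
Local Notation T := (term k S).
Local Notation W := (seq (gob S)).
Implicit Types (f g h t u : T) (a b c d : W).

Fixpoint src t : W :=
  match t with
  | Gen x => gsrc x
  | Id a => a
  | Comp f g => src g
  | Tens f g => src f ++ src g
  | Zero a b => a
  | Add f g => src f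
  | Scale z f => src f
  end.

Fixpoint tgt t : W :=
  match t with
  | Gen x => gtgt x
  | Id a => a
  | Comp f g => tgt f
  | Tens f g => tgt f ++ tgt g
  | Zero a b => b
  | Add f g => tgt f
  | Scale z f => tgt f
  end.

Fixpoint wt t : bool :=
  match t with
  | Comp f g => [&& wt f, wt g & src f == tgt g]
  | Tens f g => wt f && wt g
  | Add f g => [&& wt f, wt g, src f == src g & tgt f == tgt g]
  | Scale _ f => wt f
  | _ => true
  end.

(* Terms here need not be well typed: [eqv] only uses instances whose two
   sides are well typed, with the same domain and codomain. *)
Inductive smc_axiom : T -> T -> Prop :=
| AxCompIdL f : smc_axiom (Comp (Id (tgt f)) f) f
| AxCompIdR f : smc_axiom (Comp f (Id (src f))) f
| AxCompA f g h : smc_axiom (Comp (Comp f g) h) (Comp f (Comp g h))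
| AxTensIdL f : smc_axiom (Tens (Id [::]) f) f
| AxTensIdR f : smc_axiom (Tens f (Id [::])) f
| AxTensA f g h : smc_axiom (Tens (Tens f g) h) (Tens f (Tens g h))
| AxTensId a b : smc_axiom (Tens (Id a) (Id b)) (Id (a ++ b))
| AxTensComp f g f' g' :
    smc_axiom (Comp (Tens f f') (Tens g g')) (Tens (Comp f g) (Comp f' g'))
| AxAddA f g h : smc_axiom (Add f (Add g h)) (Add (Add f g) h)
| AxAddC f g : smc_axiom (Add f g) (Add g f)
| AxAdd0 f : smc_axiom (Add (Zero (src f) (tgt f)) f) f
| AxScale0 f : smc_axiom (Scale 0 f) (Zero (src f) (tgt f))
| AxScale1 f : smc_axiom (Scale 1 f) f
| AxScaleA z z' f : smc_axiom (Scale z (Scale z' f)) (Scale (z * z') f)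
| AxScaleDr z f g :
    smc_axiom (Scale z (Add f g)) (Add (Scale z f) (Scale z g))
| AxScaleDl z z' f :
    smc_axiom (Scale (z + z') f) (Add (Scale z f) (Scale z' f))
| AxCompDl f f' g : smc_axiom (Comp (Add f f') g) (Add (Comp f g) (Comp f' g))
| AxCompDr f g g' : smc_axiom (Comp f (Add g g')) (Add (Comp f g) (Comp f g'))
| AxCompZl z f g : smc_axiom (Comp (Scale z f) g) (Scale z (Comp f g))
| AxCompZr z f g : smc_axiom (Comp f (Scale z g)) (Scale z (Comp f g))
| AxTensDl f f' g : smc_axiom (Tens (Add f f') g) (Add (Tens f g) (Tens f' g))
| AxTensDr f g g' : smc_axiom (Tens f (Add g g')) (Add (Tens f g) (Tens f g'))
| AxTensZl z f g : smc_axiom (Tens (Scale z f) g) (Scale z (Tens f g))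
| AxTensZr z f g : smc_axiom (Tens f (Scale z g)) (Scale z (Tens f g)).

Variable rel : T -> T -> Prop.

Definition parallel t u := src t = src u /\ tgt t = tgt u.

Inductive eqv : T -> T -> Prop :=
| EqvAx t u : smc_axiom t u -> wt t -> wt u -> parallel t u -> eqv t u
| EqvRel t u : rel t u -> wt t -> wt u -> parallel t u -> eqv t u
| EqvRefl t : wt t -> eqv t t
| EqvSym t u : eqv t u -> eqv u t
| EqvTrans t u v : eqv t u -> eqv u v -> eqv t v
| EqvComp f f' g g' : src f = tgt g -> eqv f f' -> eqv g g' ->
    eqv (Comp f g) (Comp f' g')
| EqvTens f f' g g' : eqv f f' -> eqv g g' -> eqv (Tens f g) (Tens f' g')
| EqvAdd f f' g g' : parallel f g -> eqv f f' -> eqv g g' ->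
    eqv (Add f g) (Add f' g')
| EqvScale z f f' : eqv f f' -> eqv (Scale z f) (Scale z f').

Lemma eqv_typed t u : eqv t u -> [/\ wt t, wt u & parallel t u].
Proof.
rewrite /parallel; elim=> {t u} //=.
- by move=> t u _ [? ? [? ?]].
- by move=> t u v _ [? ? [-> ->]] _ [? ? [-> ->]].
- move=> f f' g g' e _ [-> -> [e1 e2]] _ [-> -> [e3 e4]].
  by rewrite -e1 -e4 -e2 -e3 e eqxx.
- by move=> f f' g g' _ [-> -> [-> ->]] _ [-> -> [-> ->]].
- move=> f f' g g' [e e'] _ [-> -> [e1 e2]] _ [-> -> [e3 e4]].
  by rewrite -e1 -e2 -e3 -e4 e e' !eqxx.
Qed.

Definition typed a b t := [&& wt t, src t == a & tgt t == b].

Definition tterm a b := {t : T | typed a b t}.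

Section Hom.
Variables a b : W.

Definition teqv (t u : tterm a b) : bool := `[< eqv (val t) (val u) >].

Lemma teqv_refl : reflexive teqv.
Proof. by move=> t; apply/asboolP/EqvRefl; case/and3P: (valP t). Qed.

Lemma teqv_sym : symmetric teqv.
Proof. by move=> t u; apply/asboolP/asboolP => /EqvSym. Qed.

Lemma teqv_trans : transitive teqv.
Proof.
by move=> u t v /asboolP h1 /asboolP h2; apply/asboolP; exact: EqvTrans h2.
Qed.

Canonical teqv_equiv := EquivRel teqv teqv_refl teqv_sym teqv_trans.

Definition phom := {eq_quot teqv}.
HB.instance Definition _ := Choice.on phom.

Definition cls t (ht : typed a b t) : phom :=
  \pi_phom (exist (typed a b) t ht : tterm a b).

Lemma cls_eq t u (ht : typed a b t) (hu : typed a b u) :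
  eqv t u <-> cls ht = cls hu.
Proof.
split=> [h|/eqmodP/asboolP //]; by apply/eqmodP/asboolP.
Qed.

Definition rep (x : phom) : T := val (repr x).

Lemma rep_typed x : typed a b (rep x). Proof. exact: (valP (repr x)). Qed.

Lemma cls_rep x : cls (rep_typed x) = x.
Proof.
rewrite -[RHS]reprK /cls; congr (\pi_phom _); exact: val_inj.
Qed.

Lemma rep_cls t (ht : typed a b t) : eqv (rep (cls ht)) t.
Proof. by apply/(cls_eq (rep_typed _) ht); rewrite cls_rep. Qed.

Lemma rep_inj x y : eqv (rep x) (rep y) -> x = y.
Proof.
by move/(cls_eq (rep_typed x) (rep_typed y)); rewrite !cls_rep.
Qed.

Lemma add_typed t u : typed a b t -> typed a b u -> typed a b (Add t u).
Proof.
by case/and3P=> ? /eqP e1 /eqP e2 /and3P[? /eqP e3 /eqP e4];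
  apply/and3P; rewrite /= e1 e2 e3 e4 !eqxx; split=> //; apply/and4P.
Qed.

Lemma scale_typed z t : typed a b t -> typed a b (Scale z t).
Proof. by []. Qed.

Lemma zero_typed : typed a b (Zero a b).
Proof. by rewrite /typed /= !eqxx. Qed.

Definition phom_zero : phom := cls zero_typed.
Definition phom_add (x y : phom) : phom :=
  cls (add_typed (rep_typed x) (rep_typed y)).
Definition phom_scale (z : k) (x : phom) : phom :=
  cls (scale_typed z (rep_typed x)).
Definition phom_opp (x : phom) : phom := phom_scale (-1) x.

Lemma typed_parallel t u : typed a b t -> typed a b u -> parallel t u.
Proof. by case/and3P=> _ /eqP e1 /eqP e2 /and3P[_ /eqP e3 /eqP e4]; split; congruence. Qed.

Lemma eqv_ax t u : smc_axiom t u -> typed a b t -> typed a b u -> eqv t u.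
Proof.
move=> h ht hu; apply: EqvAx => //; last exact: typed_parallel ht hu.
  by case/and3P: ht.
by case/and3P: hu.
Qed.

Lemma phom_addE t u (ht : typed a b t) (hu : typed a b u) :
  phom_add (cls ht) (cls hu) = cls (add_typed ht hu).
Proof.
apply/cls_eq/EqvAdd; try exact: rep_cls.
exact: typed_parallel (rep_typed _) (rep_typed _).
Qed.

Lemma phom_scaleE z t (ht : typed a b t) :
  phom_scale z (cls ht) = cls (scale_typed z ht).
Proof. by apply/cls_eq/EqvScale/rep_cls. Qed.

Lemma clsP (P : phom -> Prop) :
  (forall t (ht : typed a b t), P (cls ht)) -> forall x, P x.
Proof. by move=> h x; rewrite -(cls_rep x). Qed.

Fact phom_addA : associative phom_add.
Proof.
elim/clsP=> f hf; elim/clsP=> g hg; elim/clsP=> h hh; rewrite !phom_addE.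
by apply/cls_eq; apply: eqv_ax (AxAddA _ _ _) _ _; rewrite !add_typed.
Qed.

Fact phom_addC : commutative phom_add.
Proof.
elim/clsP=> f hf; elim/clsP=> g hg; rewrite !phom_addE.
by apply/cls_eq; apply: eqv_ax (AxAddC _ _) _ _; rewrite !add_typed.
Qed.

Fact phom_add0 : left_id phom_zero phom_add.
Proof.
elim/clsP=> f hf; rewrite phom_addE; apply/cls_eq.
case/and3P: (hf) => _ /eqP e1 /eqP e2.
apply: eqv_ax => //; last by rewrite add_typed ?zero_typed.
by rewrite -{1}e1 -{1}e2; exact: AxAdd0.
Qed.

Fact phom_scale0 x : phom_scale 0 x = phom_zero.
Proof.
elim/clsP: x => f hf; rewrite phom_scaleE; apply/cls_eq.
case/and3P: (hf) => _ /eqP e1 /eqP e2.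
apply: eqv_ax => //; last by rewrite zero_typed.
by rewrite -{1}e1 -{1}e2; exact: AxScale0.
Qed.

Fact phom_scaleA z z' x :
  phom_scale z (phom_scale z' x) = phom_scale (z * z') x.
Proof.
elim/clsP: x => f hf; rewrite !phom_scaleE.
by apply/cls_eq; apply: eqv_ax (AxScaleA _ _ _) _ _.
Qed.

Fact phom_scale1 : left_id 1 phom_scale.
Proof.
elim/clsP=> f hf; rewrite phom_scaleE; apply/cls_eq.
exact: eqv_ax (AxScale1 _) _ _.
Qed.

Fact phom_scaleDr z :
  {morph phom_scale z : x y / phom_add x y >-> phom_add x y}.
Proof.
elim/clsP=> f hf; elim/clsP=> g hg; rewrite phom_addE !phom_scaleE phom_addE.
apply/cls_eq; apply: eqv_ax (AxScaleDr _ _ _) _ _.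
  exact: (add_typed hf hg).
exact: (add_typed (scale_typed z hf) (scale_typed z hg)).
Qed.

Fact phom_scaleDl x z z' :
  phom_scale (z + z') x = phom_add (phom_scale z x) (phom_scale z' x).
Proof.
elim/clsP: x => f hf; rewrite !phom_scaleE phom_addE.
apply/cls_eq; apply: eqv_ax (AxScaleDl _ _ _) _ _ => //.
exact: (add_typed (scale_typed z hf) (scale_typed z' hf)).
Qed.

Fact phom_addN : left_inverse phom_zero phom_opp phom_add.
Proof.
move=> x; rewrite -{2}[x]phom_scale1 /phom_opp -phom_scaleDl addNr.
exact: phom_scale0.
Qed.

HB.instance Definition _ :=
  GRing.isZmodule.Build phom phom_addA phom_addC phom_add0 phom_addN.
HB.instance Definition _ := GRing.Zmodule_isLmodule.Build k phom
  phom_scaleA phom_scale1 phom_scaleDr (fun x z z' => phom_scaleDl x z z').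

End Hom.

Lemma id_typed a : typed a a (Id a).
Proof. by rewrite /typed /= eqxx. Qed.

Lemma comp_typed a b c f g :
  typed b c f -> typed a b g -> typed a c (Comp f g).
Proof.
by case/and3P=> wf /eqP e1 /eqP e2 /and3P[wg /eqP e3 /eqP e4];
  rewrite /typed /= wf wg e1 e2 e3 e4 !eqxx.
Qed.

Lemma tens_typed a b c d f g :
  typed a b f -> typed c d g -> typed (a ++ c) (b ++ d) (Tens f g).
Proof.
by case/and3P=> wf /eqP e1 /eqP e2 /and3P[wg /eqP e3 /eqP e4];
  rewrite /typed /= wf wg e1 e2 e3 e4 !eqxx.
Qed.

Definition pid a : phom a a := cls (id_typed a).
Definition pcomp a b c (x : phom b c) (y : phom a b) : phom a c :=
  cls (comp_typed (rep_typed x) (rep_typed y)).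
Definition ptens a b c d (x : phom a b) (y : phom c d) :
    phom (a ++ c) (b ++ d) :=
  cls (tens_typed (rep_typed x) (rep_typed y)).

Lemma pcompE a b c f g (hf : typed b c f) (hg : typed a b g) :
  pcomp (cls hf) (cls hg) = cls (comp_typed hf hg).
Proof.
apply/cls_eq/EqvComp; try exact: rep_cls.
by case/and3P: (rep_typed (cls hf)) => _ /eqP-> _;
  case/and3P: (rep_typed (cls hg)) => _ _ /eqP->.
Qed.

Lemma ptensE a b c d f g (hf : typed a b f) (hg : typed c d g) :
  ptens (cls hf) (cls hg) = cls (tens_typed hf hg).
Proof. by apply/cls_eq/EqvTens; exact: rep_cls. Qed.

Lemma paddE a b t u (ht : typed a b t) (hu : typed a b u) :
  cls ht + cls hu = cls (add_typed ht hu).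
Proof. exact: phom_addE. Qed.

Lemma pscaleE a b z t (ht : typed a b t) :
  z *: cls ht = cls (scale_typed z ht).
Proof. exact: phom_scaleE. Qed.

Lemma heq_cls a b a' b' t u (ht : typed a b t) (hu : typed a' b' u) :
  eqv t u -> heq (cls ht) (cls hu).
Proof.
move=> h; have [_ _ [e1 e2]] := eqv_typed h.
have [/and3P[_ /eqP f1 /eqP f2] /and3P[_ /eqP g1 /eqP g2]] := (ht, hu).
have ea : a' = a by congruence.
have eb : b' = b by congruence.
move: hu; rewrite {}ea {}eb => hu; rewrite (_ : cls ht = cls hu) //.
exact/cls_eq.
Qed.

Let pE := (pcompE, ptensE, paddE, pscaleE).

Fact pcomp1m a b (x : phom a b) : pcomp (pid b) x = x.
Proof.
elim/clsP: x => f hf; rewrite !pE; apply/cls_eq.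
apply: eqv_ax (comp_typed (id_typed _) hf) (hf).
by case/and3P: hf => _ _ /eqP<-; exact: AxCompIdL.
Qed.

Fact pcompm1 a b (x : phom a b) : pcomp x (pid a) = x.
Proof.
elim/clsP: x => f hf; rewrite !pE; apply/cls_eq.
apply: eqv_ax (comp_typed hf (id_typed _)) (hf).
by case/and3P: hf => _ /eqP<- _; exact: AxCompIdR.
Qed.

Fact pcompA a b c d (x : phom c d) (y : phom b c) (z : phom a b) :
  pcomp (pcomp x y) z = pcomp x (pcomp y z).
Proof.
elim/clsP: x => f hf; elim/clsP: y => g hg; elim/clsP: z => h hh.
rewrite !pE; apply/cls_eq; apply: eqv_ax (AxCompA _ _ _) _ _.
  exact: comp_typed (comp_typed hf hg) hh.
exact: comp_typed hf (comp_typed hg hh).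
Qed.

Fact pcomp_linl a b c (z : k) (x x' : phom b c) (y : phom a b) :
  pcomp (z *: x + x') y = z *: pcomp x y + pcomp x' y.
Proof.
elim/clsP: x => f hf; elim/clsP: x' => f' hf'; elim/clsP: y => g hg.
rewrite pscaleE paddE !pcompE pscaleE paddE; apply/cls_eq.
have h1 := comp_typed (add_typed (scale_typed z hf) hf') hg.
have h2 := add_typed (comp_typed (scale_typed z hf) hg) (comp_typed hf' hg).
apply: EqvTrans (eqv_ax (AxCompDl _ _ _) h1 h2) _.
apply: EqvAdd; last 1 first.
- by apply: EqvRefl; case/and3P: (comp_typed hf' hg).
- exact: typed_parallel (comp_typed (scale_typed z hf) hg) (comp_typed hf' hg).
exact: eqv_ax (AxCompZl _ _ _) (comp_typed (scale_typed z hf) hg)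
  (scale_typed z (comp_typed hf hg)).
Qed.

Fact pcomp_linr a b c (z : k) (x : phom b c) (y y' : phom a b) :
  pcomp x (z *: y + y') = z *: pcomp x y + pcomp x y'.
Proof.
elim/clsP: x => f hf; elim/clsP: y => g hg; elim/clsP: y' => g' hg'.
rewrite pscaleE paddE !pcompE pscaleE paddE; apply/cls_eq.
have h1 := comp_typed hf (add_typed (scale_typed z hg) hg').
have h2 := add_typed (comp_typed hf (scale_typed z hg)) (comp_typed hf hg').
apply: EqvTrans (eqv_ax (AxCompDr _ _ _) h1 h2) _.
apply: EqvAdd; last 1 first.
- by apply: EqvRefl; case/and3P: (comp_typed hf hg').
- exact: typed_parallel (comp_typed hf (scale_typed z hg)) (comp_typed hf hg').
exact: eqv_ax (AxCompZr _ _ _) (comp_typed hf (scale_typed z hg))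
  (scale_typed z (comp_typed hf hg)).
Qed.

Fact ptens_linl a b c d (z : k) (x x' : phom a b) (y : phom c d) :
  ptens (z *: x + x') y = z *: ptens x y + ptens x' y.
Proof.
elim/clsP: x => f hf; elim/clsP: x' => f' hf'; elim/clsP: y => g hg.
rewrite pscaleE paddE !ptensE pscaleE paddE; apply/cls_eq.
have h1 := tens_typed (add_typed (scale_typed z hf) hf') hg.
have h2 := add_typed (tens_typed (scale_typed z hf) hg) (tens_typed hf' hg).
apply: EqvTrans (eqv_ax (AxTensDl _ _ _) h1 h2) _.
apply: EqvAdd; last 1 first.
- by apply: EqvRefl; case/and3P: (tens_typed hf' hg).
- exact: typed_parallel (tens_typed (scale_typed z hf) hg) (tens_typed hf' hg).
exact: eqv_ax (AxTensZl _ _ _) (tens_typed (scale_typed z hf) hg)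
  (scale_typed z (tens_typed hf hg)).
Qed.

Fact ptens_linr a b c d (z : k) (x : phom a b) (y y' : phom c d) :
  ptens x (z *: y + y') = z *: ptens x y + ptens x y'.
Proof.
elim/clsP: x => f hf; elim/clsP: y => g hg; elim/clsP: y' => g' hg'.
rewrite pscaleE paddE !ptensE pscaleE paddE; apply/cls_eq.
have h1 := tens_typed hf (add_typed (scale_typed z hg) hg').
have h2 := add_typed (tens_typed hf (scale_typed z hg)) (tens_typed hf hg').
apply: EqvTrans (eqv_ax (AxTensDr _ _ _) h1 h2) _.
apply: EqvAdd; last 1 first.
- by apply: EqvRefl; case/and3P: (tens_typed hf hg').
- exact: typed_parallel (tens_typed hf (scale_typed z hg)) (tens_typed hf hg').
exact: eqv_ax (AxTensZr _ _ _) (tens_typed hf (scale_typed z hg))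
  (scale_typed z (tens_typed hf hg)).
Qed.

Fact ptens_id a c : ptens (pid a) (pid c) = pid (a ++ c).
Proof.
rewrite !pE; apply/cls_eq; apply: eqv_ax (AxTensId _ _) _ _.
  exact: tens_typed (id_typed a) (id_typed c).
exact: id_typed.
Qed.

Fact ptens_comp a b c a' b' c' (x : phom b c) (y : phom a b)
    (x' : phom b' c') (y' : phom a' b') :
  pcomp (ptens x x') (ptens y y') = ptens (pcomp x y) (pcomp x' y').
Proof.
elim/clsP: x => f hf; elim/clsP: y => g hg.
elim/clsP: x' => f' hf'; elim/clsP: y' => g' hg'.
rewrite !pE; apply/cls_eq; apply: eqv_ax (AxTensComp _ _ _ _) _ _.
  exact: comp_typed (tens_typed hf hf') (tens_typed hg hg').
exact: tens_typed (comp_typed hf hg) (comp_typed hf' hg').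
Qed.

Fact ptensA a b c a' b' c' (x : phom a a') (y : phom b b') (z : phom c c') :
  heq (ptens (ptens x y) z) (ptens x (ptens y z)).
Proof.
elim/clsP: x => f hf; elim/clsP: y => g hg; elim/clsP: z => h hh.
rewrite !pE; apply: heq_cls.
have h1 := tens_typed (tens_typed hf hg) hh.
have h2 := tens_typed hf (tens_typed hg hh).
by apply: eqv_ax (AxTensA _ _ _) h1 _; rewrite -!catA.
Qed.

Fact ptens1m a b (x : phom a b) : heq (ptens (pid [::]) x) x.
Proof.
elim/clsP: x => f hf; rewrite !pE; apply: heq_cls.
exact: eqv_ax (AxTensIdL _) (tens_typed (id_typed _) hf) hf.
Qed.

Fact ptensm1 a b (x : phom a b) : heq (ptens x (pid [::])) x.
Proof.
elim/clsP: x => f hf; rewrite !pE; apply: heq_cls.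
have h1 := tens_typed hf (id_typed [::]).
by apply: eqv_ax (AxTensIdR _) h1 _; rewrite !cats0.
Qed.

Definition presented : smcat k :=
  @SMCat k W phom pid pcomp [::] cat ptens
    pcomp1m pcompm1 pcompA pcomp_linl pcomp_linr ptens_linl ptens_linr
    ptens_id ptens_comp (fun a b c => esym (catA a b c))
    (@cat0s _) (@cats0 _)
    ptensA ptens1m ptensm1.

Lemma wt_typed t : wt t -> typed (src t) (tgt t) t.
Proof. by move=> h; rewrite /typed h !eqxx. Qed.

Definition mor t (ht : wt t) : hom presented (src t) (tgt t) :=
  cls (wt_typed ht).

Definition gen_mor (x : gmor S) : hom presented (gsrc x) (gtgt x) :=
  @mor (Gen x) isT.

End Presentation.

Arguments src {k S} t.
Arguments tgt {k S} t.
Arguments wt {k S} t.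
Arguments parallel {k S} t u.
Arguments presented {k S} rel.
Arguments mor {k S} rel t ht.
Arguments gen_mor {k S} rel x.

Section Quantum.
Variables (k : fieldType) (q : k).

Definition qint (n : nat) : k := (q ^+ n - q ^- n) / (q - q^-1).
Definition qfact (a : nat) : k := \prod_(i < a) qint i.+1.
Definition qbin (n a : nat) : k := (\prod_(i < a) qint (n - i)) / qfact a.

End Quantum.

Definition posn := {n : nat | (0 < n)%N}.

Definition succp (n : nat) : posn := exist (fun n => 0 < n)%N n.+1 isT.

(* The object of thickness n; thickness 0 is the unit object. *)
Definition thk (n : nat) : seq posn :=
  if n is n'.+1 then [:: succp n'] else [::].

(* [D] indexes the dots, [dthk] gives their thickness. [WCi] and [WDi] are
   adjoined inverses of the crossings and of the dots. *)
Inductive webgen (D : Type) : Type :=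
| WM of posn & posn
| WS of posn & posn
| WC of posn & posn
| WCi of posn & posn
| WD of D
| WDi of D.
Arguments WM {D} _ _.
Arguments WS {D} _ _.
Arguments WC {D} _ _.
Arguments WCi {D} _ _.

Section Webs.
Variables (k : fieldType) (q : k).

Section Common.
Variables (D : Type) (dthk : D -> posn).

Definition web_src (x : webgen D) : seq posn :=
  match x with
  | WM a b | WC a b => [:: a; b]
  | WS a b => thk (val a + val b)
  | WCi a b => [:: b; a]
  | WD i | WDi i => [:: dthk i]
  end.

Definition web_tgt (x : webgen D) : seq posn :=
  match x with
  | WM a b => thk (val a + val b)
  | WS a b | WCi a b => [:: a; b]
  | WC a b => [:: b; a]
  | WD i | WDi i => [:: dthk i]
  end.

Definition web_sig : signature := Signature web_src web_tgt.

Local Notation T := (term k web_sig).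
Local Open Scope smc_scope.

Definition idt (a : nat) : T := Id (thk a : seq (gob web_sig)).

Definition gen (x : webgen D) : T := @Gen k web_sig x.

Definition merge (a b : nat) : T :=
  match a, b with
  | a'.+1, b'.+1 => gen (WM (succp a') (succp b'))
  | _, _ => idt (a + b)
  end.

Definition split (a b : nat) : T :=
  match a, b with
  | a'.+1, b'.+1 => gen (WS (succp a') (succp b'))
  | _, _ => idt (a + b)
  end.

Definition cross (a b : nat) : T :=
  match a, b with
  | a'.+1, b'.+1 => gen (WC (succp a') (succp b'))
  | _, _ => idt (a + b)
  end.

(* The inverse of [cross a b], so [crossV a b : b ⊗ a -> a ⊗ b]. *)
Definition crossV (a b : nat) : T :=
  match a, b with
  | a'.+1, b'.+1 => gen (WCi (succp a') (succp b'))
  | _, _ => idt (a + b)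
  end.

Fixpoint merges (r : seq nat) : T :=
  if r is a :: r' then merge a (sumn r') ∘ (idt a ⊗ merges r') else Id [::].

Fixpoint splits (r : seq nat) : T :=
  if r is a :: r' then (idt a ⊗ splits r') ∘ split a (sumn r') else Id [::].

Fixpoint tpow (t : T) (n : nat) : T :=
  if n is n'.+1 then t ⊗ tpow t n' else Id [::].

Definition mts (t : T) (a : nat) : T :=
  merges (nseq a 1%N) ∘ tpow t a ∘ splits (nseq a 1%N).

(* The side conditions of [RSwitch] give c - t = b - s and a - s = d - t. *)
Definition square_switch (a b c d s t : nat) : T :=
  (merge s (b - s) ⊗ merge (a - s) t)
  ∘ (idt s ⊗ cross (a - s) (c - t) ⊗ idt t)
  ∘ (split s (a - s) ⊗ split (c - t) t).

Inductive web_rel_common : T -> T -> Prop :=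
| RMergeA a b c : (0 < a)%N -> (0 < b)%N -> (0 < c)%N ->
    web_rel_common (merge (a + b) c ∘ (merge a b ⊗ idt c))
                   (merge a (b + c) ∘ (idt a ⊗ merge b c))
| RSplitA a b c : (0 < a)%N -> (0 < b)%N -> (0 < c)%N ->
    web_rel_common ((split a b ⊗ idt c) ∘ split (a + b) c)
                   ((idt a ⊗ split b c) ∘ split a (b + c))
| RSwitch a b c d : (0 < a)%N -> (0 < b)%N -> (0 < c)%N -> (0 < d)%N ->
    (a + c = b + d)%N ->
    web_rel_common (split b d ∘ merge a c)
      (\big[@Add _ _/Zero (thk a ++ thk c : seq (gob web_sig))
                          (thk b ++ thk d : seq (gob web_sig))]_
         (p : 'I_(minn a b).+1 * 'I_(minn c d).+1 | (p.2 + a == p.1 + d)%N)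
         Scale (q ^+ (p.1 * p.2)) (square_switch a b c d p.1 p.2))
| RBubble a b : (0 < a)%N -> (0 < b)%N ->
    web_rel_common (merge a b ∘ split a b)
                   (Scale (qbin q (a + b) a) (idt (a + b)))
| RCrossV a b : (0 < a)%N -> (0 < b)%N ->
    web_rel_common (crossV a b ∘ cross a b) (idt a ⊗ idt b)
| RVCross a b : (0 < a)%N -> (0 < b)%N ->
    web_rel_common (cross a b ∘ crossV a b) (idt b ⊗ idt a)
| RDotV i :
    web_rel_common (gen (WDi i) ∘ gen (WD i)) (idt (val (dthk i)))
| RVDot i :
    web_rel_common (gen (WD i) ∘ gen (WDi i)) (idt (val (dthk i))).

End Common.

Definition dot (a : nat) : term k (web_sig id) :=
  if a is a'.+1 then gen id (WD (succp a')) else idt id 0.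

Definition dotV (a : nat) : term k (web_sig id) :=
  if a is a'.+1 then gen id (WDi (succp a')) else idt id 0.

Local Open Scope smc_scope.

Inductive web_rel : term k (web_sig id) -> term k (web_sig id) -> Prop :=
| RCommon t u : web_rel_common t u -> web_rel t u
| RDotCrossL a b : (0 < a)%N -> (0 < b)%N ->
    web_rel (cross id a b ∘ (dot a ⊗ idt id b))
            ((idt id b ⊗ dot a) ∘ crossV id b a)
| RDotCrossR a b : (0 < a)%N -> (0 < b)%N ->
    web_rel ((dot b ⊗ idt id a) ∘ cross id a b)
            (crossV id b a ∘ (idt id a ⊗ dot b))
| RSplitDot a b : (0 < a)%N -> (0 < b)%N ->
    web_rel (split id a b ∘ dot (a + b)) ((dot a ⊗ dot b) ∘ split id a b)
| RDotMerge a b : (0 < a)%N -> (0 < b)%N ->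
    web_rel (dot (a + b) ∘ merge id a b) (merge id a b ∘ (dot a ⊗ dot b))
| RDotPow a : (0 < a)%N ->
    web_rel (mts (dot 1) a) (Scale (qfact q a) (dot a))
| RDotVPow a : (0 < a)%N ->
    web_rel (mts (dotV 1) a) (Scale (qfact q a) (dotV a)).

Definition dthk' (_ : unit) : posn := succp 0.

Definition dot1' : term k (web_sig dthk') := gen dthk' (WD tt).
Definition dot1V' : term k (web_sig dthk') := gen dthk' (WDi tt).

Inductive web_rel' : term k (web_sig dthk') -> term k (web_sig dthk') -> Prop :=
| RCommon' t u : web_rel_common t u -> web_rel' t u
| RDotCrossL' :
    web_rel' (cross dthk' 1 1 ∘ (dot1' ⊗ idt dthk' 1))
             ((idt dthk' 1 ⊗ dot1') ∘ crossV dthk' 1 1)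
| RDotCrossR' :
    web_rel' ((dot1' ⊗ idt dthk' 1) ∘ cross dthk' 1 1)
             (crossV dthk' 1 1 ∘ (idt dthk' 1 ⊗ dot1')).

Definition Web : smcat k := presented web_rel.
Definition Web' : smcat k := presented web_rel'.

Definition xdef' (a : nat) : term k (web_sig dthk') :=
  Scale (qfact q a)^-1 (mts dot1' a).
Definition xVdef' (a : nat) : term k (web_sig dthk') :=
  Scale (qfact q a)^-1 (mts dot1V' a).

Section Typing.
Variables (D : Type) (dthk : D -> posn).

Lemma thk_val (a : posn) : thk (val a) = [:: a].
Proof. by case: a => -[|n] //= h; congr [:: _]; exact: val_inj. Qed.

Lemma merge_typed a b :
  typed (S := web_sig dthk) (thk a ++ thk b) (thk (a + b)) (merge dthk a b).
Proof.
by case: a b => [|a] [|b]; rewrite /typed /= ?addn0 ?eqxx.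
Qed.

Lemma split_typed a b :
  typed (S := web_sig dthk) (thk (a + b)) (thk a ++ thk b) (split dthk a b).
Proof.
by case: a b => [|a] [|b]; rewrite /typed /= ?addn0 ?eqxx.
Qed.

Lemma cross_typed a b :
  typed (S := web_sig dthk) (thk a ++ thk b) (thk b ++ thk a) (cross dthk a b).
Proof.
by case: a b => [|a] [|b]; rewrite /typed /= ?addn0 ?eqxx.
Qed.

Lemma crossV_typed a b :
  typed (S := web_sig dthk) (thk b ++ thk a) (thk a ++ thk b) (crossV dthk a b).
Proof.
by case: a b => [|a] [|b]; rewrite /typed /= ?addn0 ?eqxx.
Qed.

Lemma idt_typed a : typed (S := web_sig dthk) (thk a) (thk a) (idt dthk a).
Proof. exact: id_typed. Qed.

Lemma merges_typed r :
  typed (S := web_sig dthk) (flatten (map thk r)) (thk (sumn r))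
    (merges dthk r).
Proof.
elim: r => //= a r IH.
exact: comp_typed (merge_typed _ _) (tens_typed (idt_typed _) IH).
Qed.

Lemma splits_typed r :
  typed (S := web_sig dthk) (thk (sumn r)) (flatten (map thk r))
    (splits dthk r).
Proof.
elim: r => //= a r IH.
exact: comp_typed (tens_typed (idt_typed _) IH) (split_typed _ _).
Qed.

Lemma mts_typed t a : typed (S := web_sig dthk) (thk 1) (thk 1) t ->
  typed (S := web_sig dthk) (thk a) (thk a) (mts t a).
Proof.
move=> ht; have hp : typed (S := web_sig dthk) (flatten (map thk (nseq a 1%N)))
    (flatten (map thk (nseq a 1%N))) (tpow t a).
  by elim: a => //= a IH; exact: tens_typed ht IH.
have hm := merges_typed (nseq a 1%N); have hs := splits_typed (nseq a 1%N).
rewrite sumn_nseq mul1n in hm hs.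
exact: comp_typed (comp_typed hm hp) hs.
Qed.

Lemma web_rel_common_typed t u : @web_rel_common D dthk t u ->
  exists a b, typed a b t /\ typed a b u.
Proof.
case.
- move=> a b c _ _ _; exists (thk a ++ thk b ++ thk c), (thk (a + (b + c))).
  split; last exact: comp_typed (merge_typed _ _)
    (tens_typed (idt_typed _) (merge_typed _ _)).
  rewrite catA addnA.
  exact: comp_typed (merge_typed _ _) (tens_typed (merge_typed _ _) (idt_typed _)).
- move=> a b c _ _ _; exists (thk (a + (b + c))), (thk a ++ thk b ++ thk c).
  split; last exact: comp_typed
    (tens_typed (idt_typed _) (split_typed _ _)) (split_typed _ _).
  rewrite catA addnA.
  exact: comp_typed (tens_typed (split_typed _ _) (idt_typed _)) (split_typed _ _).
- move=> a b c d _ _ _ _ e; exists (thk a ++ thk c), (thk b ++ thk d); split.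
    apply: comp_typed (merge_typed _ _); rewrite e; exact: split_typed.
  apply: (big_ind (fun t => typed _ _ t)) => [||[[s hs] [t' ht]] /= /eqP hst].
  + exact: zero_typed.
  + by move=> x y; exact: add_typed.
  apply: scale_typed; move: hs ht; rewrite !ltnS !leq_min => /andP[sa sb] /andP[tc td].
  apply: comp_typed (comp_typed _ _) _.
  + have -> : thk b = thk (s + (b - s)) by rewrite subnKC.
    have -> : thk d = thk ((a - s) + t') by congr thk; lia.
    exact: tens_typed (merge_typed _ _) (merge_typed _ _).
  + have -> : (b - s = c - t')%N by lia.
    rewrite (catA _ (thk _)) -(catA (thk s)).
    exact: tens_typed (tens_typed (idt_typed _) (cross_typed _ _)) (idt_typed _).
  + have {1}-> : thk a = thk (s + (a - s)) by rewrite subnKC.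
    have {1}-> : thk c = thk ((c - t') + t') by rewrite subnK.
    rewrite -!catA (catA (thk s)).
    exact: tens_typed (split_typed _ _) (split_typed _ _).
- move=> a b _ _; exists (thk (a + b)), (thk (a + b)); split.
    exact: comp_typed (merge_typed _ _) (split_typed _ _).
  exact: scale_typed (idt_typed _).
- move=> a b _ _; exists (thk a ++ thk b), (thk a ++ thk b); split.
    exact: comp_typed (crossV_typed _ _) (cross_typed _ _).
  exact: tens_typed (idt_typed _) (idt_typed _).
- move=> a b _ _; exists (thk b ++ thk a), (thk b ++ thk a); split.
    exact: comp_typed (cross_typed _ _) (crossV_typed _ _).
  exact: tens_typed (idt_typed _) (idt_typed _).
- move=> i; exists [:: dthk i], [:: dthk i].
  by rewrite /typed /= /idt thk_val !eqxx.
- move=> i; exists [:: dthk i], [:: dthk i].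
  by rewrite /typed /= /idt thk_val !eqxx.
Qed.

End Typing.

Lemma dot_typed a : typed (S := web_sig id) (thk a) (thk a) (dot a).
Proof. by case: a => [|a]; rewrite /typed /= ?eqxx. Qed.

Lemma dotV_typed a : typed (S := web_sig id) (thk a) (thk a) (dotV a).
Proof. by case: a => [|a]; rewrite /typed /= ?eqxx. Qed.

Lemma dot1_typed' : typed (S := web_sig dthk') (thk 1) (thk 1) dot1'.
Proof. by []. Qed.

Lemma dot1V_typed' : typed (S := web_sig dthk') (thk 1) (thk 1) dot1V'.
Proof. by []. Qed.

(* Since [eqv] disregards ill-typed relations, these two lemmas ensure that
   none of the defining relations is lost. *)
Lemma web_rel_typed t u : web_rel t u ->
  exists a b, typed a b t /\ typed a b u.
Proof.
case.
- by move=> {}t {}u; exact: web_rel_common_typed.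
- move=> a b _ _; exists (thk a ++ thk b), (thk b ++ thk a); split.
    exact: comp_typed (cross_typed _ _ _) (tens_typed (dot_typed _) (idt_typed _ _)).
  exact: comp_typed (tens_typed (idt_typed _ _) (dot_typed _)) (crossV_typed _ _ _).
- move=> a b _ _; exists (thk a ++ thk b), (thk b ++ thk a); split.
    exact: comp_typed (tens_typed (dot_typed _) (idt_typed _ _)) (cross_typed _ _ _).
  exact: comp_typed (crossV_typed _ _ _) (tens_typed (idt_typed _ _) (dot_typed _)).
- move=> a b _ _; exists (thk (a + b)), (thk a ++ thk b); split.
    exact: comp_typed (split_typed _ _ _) (dot_typed _).
  exact: comp_typed (tens_typed (dot_typed _) (dot_typed _)) (split_typed _ _ _).
- move=> a b _ _; exists (thk a ++ thk b), (thk (a + b)); split.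
    exact: comp_typed (dot_typed _) (merge_typed _ _ _).
  exact: comp_typed (merge_typed _ _ _) (tens_typed (dot_typed _) (dot_typed _)).
- move=> a _; exists (thk a), (thk a); split.
    exact: mts_typed (dot_typed 1).
  exact: scale_typed (dot_typed _).
- move=> a _; exists (thk a), (thk a); split.
    exact: mts_typed (dotV_typed 1).
  exact: scale_typed (dotV_typed _).
Qed.

Lemma web_rel_typed' t u : web_rel' t u ->
  exists a b, typed a b t /\ typed a b u.
Proof.
case=> [{}t {}u||]; first exact: web_rel_common_typed.
  by exists (thk 1 ++ thk 1), (thk 1 ++ thk 1).
by exists (thk 1 ++ thk 1), (thk 1 ++ thk 1).
Qed.

Lemma xdef_wt' a : wt (xdef' a).
Proof. by case/and3P: (mts_typed a dot1_typed'). Qed.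

Lemma xVdef_wt' a : wt (xVdef' a).
Proof. by case/and3P: (mts_typed a dot1V_typed'). Qed.

Definition web_m (a b : posn) := gen_mor web_rel (WM a b).
Definition web_s (a b : posn) := gen_mor web_rel (WS a b).
Definition web_c (a b : posn) := gen_mor web_rel (WC a b).
Definition web_x (a : posn) := gen_mor web_rel (WD a).
Definition web_xV (a : posn) := gen_mor web_rel (WDi a).

Definition web_m' (a b : posn) := gen_mor web_rel' (WM a b).
Definition web_s' (a b : posn) := gen_mor web_rel' (WS a b).
Definition web_c' (a b : posn) := gen_mor web_rel' (WC a b).
Definition web_x1' := gen_mor web_rel' (WD tt).
Definition web_xdef' (a : nat) := mor web_rel' (xdef' a) (xdef_wt' a).
Definition web_xVdef' (a : nat) := mor web_rel' (xVdef' a) (xVdef_wt' a).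

End Webs.

(* C(q), with C modelled as R[i]. *)
Definition Cq (R : realType) : fieldType := {fraction {poly R[i]}}.
Definition qvar (R : realType) : Cq R := tofrac ('X : {poly R[i]}).

(* Main.v *)
From HB Require Import structures.
Require Import Defs.
From mathcomp Require Import all_boot all_algebra reals.
From mathcomp Require Import generic_quotient fraction zify complex boolp.

Set Implicit Arguments.
Unset Strict Implicit.
Unset Printing Implicit Defensive.

Import GRing.Theory.
Local Open Scope ring_scope.
Local Open Scope quotient_scope.
(** The category Web is generated by more dots than Web', but all its relations
are consequences of those of Web'.  The functor Web' -> Web matches the
generators; its inverse sends the thick dot x_a to
[a]!^-1 m_{1^a} x_1^{⊗a} s_{1^a}, and the work is to show that these elements
of Web' are invertible and satisfy (W4), (W5) and (W6) for all thicknesses.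

Dots and splits (W5).  By associativity the thick dots obey
x_{n+1} = [n+1]^-1 m_{1,n} (x_1 ⊗ x_n) s_{1,n}.  By (W2),
s_{1,n+1} m_{1,n+1} = (1 ⊗ m_{1,n}) (c_{1,1} ⊗ 1) (1 ⊗ s_{1,n}) + q^{n+1}.
Relation (W4) for thickness 1 implies that x_1 ⊗ x_1 commutes with c_{1,1}, so
by induction x_1 ⊗ x_n commutes with s_{1,n} m_{1,n}, and (W3) gives (W5) for
m_{1,n} and s_{1,n} ([dots1]).  The general case follows by (co)associativity,
because (W3) makes every split a split monomorphism and every merge a split
epimorphism ([split_dots], [merge_dots]).  The same argument applies to the
inverse dots, and the product of the two thick dots is found to be 1 after
composition with a split ([dots_inv]).

Sliding.  The key fact on crossings is that splits slide through them,
(1_b ⊗ s_{1,a}) c_{a+1,b} = (c_{1,b} ⊗ 1_a) (1_1 ⊗ c_{a,b}) (s_{1,a} ⊗ 1_b),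
together with its mirror image; only (W1), (W2) and (W3) are needed
([slideL_step], [slides]).  One computes
(1_b ⊗ s_{1,a}) s_{b,a+1} m_{a+1,b} = (s_{b,1} ⊗ 1_a) s_{b+1,a} m_{a+1,b}
in two ways.  On each side (W2) expands the split of the merge m_{a+1,b}, and a
second use of (W2) moves the remaining split below the new merges.  Both sides
become sums of the same two families of diagrams, by the smaller instances of
the sliding relation and of its mirror image, except for one term on each side:
those are the two sides of the relation wanted.

Dots and crossings (W4).  As crossings are invertible, (W4) amounts to
c_{a,b} (x_a ⊗ 1) c_{b,a} = 1 ⊗ x_a.  Sliding splits of both strands reduces it
to the case a = b = 1, which is part of the definition of Web'
([dot1_cross], [dots_cross]).

Computations take place in the set of all terms, well typed or not, modulo the
relations, all ill-typed terms being identified ([untyped]).  Composition and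
tensor product are total there and equations are plain equalities;
associativity holds without typing conditions, and only identities and the
interchange law need some.  The laws used are collected in the records
[diagalg] and [webalg]; exchanging the factors of tensor products gives another
such structure ([mirror_web]), so that each lemma yields its mirror image. *)

(** * Untyped diagram algebras *)

(** The morphisms of a strict k-linear monoidal category, all homs together:
the operations are total, and [dty f a b] says that f is a morphism from a to
b.  Ill-typed composites are elements of [dmor] about which nothing is said but
the unconditional laws.  In the two interchange laws [dinterl] and [dinterr] it
is enough that one of the two composites is well typed. *)
Record diagalg (k : fieldType) := DiagAlg {
  dob : Type;
  dnil : dob;
  dcat : dob -> dob -> dob;
  dcat0s : forall a, dcat dnil a = a;
  dcats0 : forall a, dcat a dnil = a;
  dcatA : forall a b c, dcat (dcat a b) c = dcat a (dcat b c);
  dmor :> Type;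
  dty : dmor -> dob -> dob -> Prop;
  did : dob -> dmor;
  dcomp : dmor -> dmor -> dmor;
  dtens : dmor -> dmor -> dmor;
  dadd : dmor -> dmor -> dmor;
  dscale : k -> dmor -> dmor;
  ty_id : forall a, dty (did a) a a;
  ty_comp : forall f g a b c, dty f b c -> dty g a b -> dty (dcomp f g) a c;
  ty_tens : forall f g a b c d,
    dty f a b -> dty g c d -> dty (dtens f g) (dcat a c) (dcat b d);
  ty_add : forall f g a b, dty f a b -> dty g a b -> dty (dadd f g) a b;
  ty_scale : forall z f a b, dty f a b -> dty (dscale z f) a b;
  dcompA : forall f g h, dcomp (dcomp f g) h = dcomp f (dcomp g h);
  dcomp1m : forall f a b, dty f a b -> dcomp (did b) f = f;
  dcompm1 : forall f a b, dty f a b -> dcomp f (did a) = f;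
  dtensA : forall f g h, dtens (dtens f g) h = dtens f (dtens g h);
  dtens1m : forall f, dtens (did dnil) f = f;
  dtensm1 : forall f, dtens f (did dnil) = f;
  dtens_id : forall a b, dtens (did a) (did b) = did (dcat a b);
  dinterl : forall f g f' g' a b c, dty f b c -> dty g a b ->
    dcomp (dtens f f') (dtens g g') = dtens (dcomp f g) (dcomp f' g');
  dinterr : forall f g f' g' a b c, dty f' b c -> dty g' a b ->
    dcomp (dtens f f') (dtens g g') = dtens (dcomp f g) (dcomp f' g');
  daddA : forall f g h, dadd f (dadd g h) = dadd (dadd f g) h;
  daddC : forall f g, dadd f g = dadd g f;
  dadd_scale0 : forall f g a b, dty f a b -> dty g a b ->
    dadd (dscale 0 f) g = g;
  dscale1 : forall f, dscale 1 f = f;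
  dscaleA : forall z z' f, dscale z (dscale z' f) = dscale (z * z') f;
  dscaleDr : forall z f g, dscale z (dadd f g) = dadd (dscale z f) (dscale z g);
  dscaleDl : forall z z' f,
    dscale (z + z') f = dadd (dscale z f) (dscale z' f);
  dcompDl : forall f f' g, dcomp (dadd f f') g = dadd (dcomp f g) (dcomp f' g);
  dcompDr : forall f g g', dcomp f (dadd g g') = dadd (dcomp f g) (dcomp f g');
  dcompZl : forall z f g, dcomp (dscale z f) g = dscale z (dcomp f g);
  dcompZr : forall z f g, dcomp f (dscale z g) = dscale z (dcomp f g);
  dtensDl : forall f f' g, dtens (dadd f f') g = dadd (dtens f g) (dtens f' g);
  dtensDr : forall f g g', dtens f (dadd g g') = dadd (dtens f g) (dtens f g');
  dtensZl : forall z f g, dtens (dscale z f) g = dscale z (dtens f g);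
  dtensZr : forall z f g, dtens f (dscale z g) = dscale z (dtens f g)
}.
Arguments did {k _} a.
Arguments dcomp {k _} f g.
Arguments dtens {k _} f g.
Arguments dadd {k _} f g.
Arguments dscale {k _} z f.
Arguments dty {k _} f a b.
Arguments dcat {k _} a b.

Reserved Notation "f • g" (at level 49, right associativity).
Reserved Notation "f ⊠ g" (at level 47, right associativity).
Reserved Notation "f ⊞ g" (at level 52, left associativity).
Declare Scope diag_scope.
Delimit Scope diag_scope with diag.
Notation "f • g" := (dcomp f g) : diag_scope.
Notation "f ⊠ g" := (dtens f g) : diag_scope.
Notation "f ⊞ g" := (dadd f g) : diag_scope.
Notation "z ⋅ f" := (dscale z f) (at level 44, right associativity) : diag_scope.
Local Open Scope diag_scope.

(** * Finite sums *)

Section Sums.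
Variables (k : fieldType) (D : diagalg k).
Implicit Types (f g h x y z : D) (n : nat) (F G : nat -> D).

(** z + F 0 + ... + F (n - 1).  The first term is a parameter since there is no
zero common to all homs. *)
Fixpoint usum z n F : D := if n is n'.+1 then usum z n' F ⊞ F n' else z.

Lemma usum_addl x z n F : usum (x ⊞ z) n F = x ⊞ usum z n F.
Proof. by elim: n => //= n ->; rewrite daddA. Qed.

Lemma usum_recl z n F : usum z n.+1 F = usum (z ⊞ F 0) n (fun i => F i.+1).
Proof. by elim: n => //= n <-. Qed.

Lemma usumC z m n F G : usum (usum z m F) n G = usum (usum z n G) m F.
Proof.
elim: m => //= m <-; rewrite daddC usum_addl daddC; congr (_ ⊞ _).
Qed.

Lemma eq_usum z n F G : (forall i, (i < n)%N -> F i = G i) ->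
  usum z n F = usum z n G.
Proof.
elim: n => //= n IH h; rewrite IH ?h // => i hi; apply: h; exact: ltnW.
Qed.

Lemma comp_usumr f z n F :
  f • usum z n F = usum (f • z) n (fun i => f • F i).
Proof. by elim: n => //= n IH; rewrite dcompDr IH. Qed.

(** The sum of x and, when b holds, of y. *)
Definition cadd (b : bool) x y := if b then x ⊞ y else x.

Lemma caddZ (c : k) b x y : c ⋅ cadd b x y = cadd b (c ⋅ x) (c ⋅ y).
Proof. by case: b => //=; rewrite dscaleDr. Qed.

Lemma usum_cadd z n p F G :
  usum z n (fun i => cadd (i < p)%N (F i) (G i)) =
  usum (usum z n F) (minn n p) G.
Proof.
elim: n => [|n IH] /=; first by rewrite min0n.
rewrite IH /cadd; case: ifP => h.
  have -> : minn n.+1 p = n.+1 by lia.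
  have -> : minn n p = n by lia.
  rewrite /= daddA (daddC (usum z n F)) usum_addl; congr (_ ⊞ _).
  by rewrite daddC.
have -> : minn n.+1 p = p by lia.
have -> : minn n p = p by lia.
by rewrite daddC -usum_addl daddC.
Qed.

(** Addition is cancellative on each hom: subtract with the scalar -1. *)
Lemma daddIr f x y a b : dty f a b -> dty x a b -> dty y a b ->
  x ⊞ f = y ⊞ f -> x = y.
Proof.
move=> tf tx ty e.
have H u : dty u a b -> (u ⊞ f) ⊞ (-1) ⋅ f = u.
  move=> tu; rewrite -daddA daddC -{1}[f]dscale1 -dscaleDl subrr.
  exact: dadd_scale0 tf tu.
by rewrite -(H x tx) e H.
Qed.

Lemma ty_usum z n F a b : dty z a b -> (forall i, (i < n)%N -> dty (F i) a b) ->
  dty (usum z n F) a b.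
Proof.
move=> tz; elim: n => //= n IH tF; apply: ty_add (tF _ _) => //.
by apply: IH => i hi; apply: tF; exact: ltnW.
Qed.

Lemma usumI n F x y a b : dty x a b -> dty y a b ->
  (forall i, (i < n)%N -> dty (F i) a b) -> usum x n F = usum y n F -> x = y.
Proof.
move=> tx ty; elim: n => //= n IH tF /daddIr e.
have tF' i : (i < n)%N -> dty (F i) a b by move=> hi; apply: tF; exact: ltnW.
apply: IH => //; apply: e; [exact: tF | exact: ty_usum | exact: ty_usum].
Qed.

End Sums.

(** * Web algebras and their mirror images *)

Section Mirror.
Variables (k : fieldType) (D : diagalg k).

(** The opposite tensor product, on objects and on morphisms: reflection of
diagrams in a vertical line. *)
Definition mirror_alg : diagalg k.
Proof.
refine (@DiagAlg k (dob D) (dnil D) (fun a b => dcat b a)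
  (@dcats0 k D) (@dcat0s k D) (fun a b c => esym (dcatA c b a))
  (dmor D) (@dty k D) (@did k D) (@dcomp k D) (fun f g => dtens g f)
  (@dadd k D) (@dscale k D) (@ty_id k D) (@ty_comp k D) _ (@ty_add k D)
  (@ty_scale k D) (@dcompA k D) (@dcomp1m k D) (@dcompm1 k D)
  (fun f g h => esym (dtensA h g f)) (@dtensm1 k D) (@dtens1m k D)
  (fun a b => dtens_id b a) _ _ (@daddA k D) (@daddC k D) (@dadd_scale0 k D)
  (@dscale1 k D) (@dscaleA k D) (@dscaleDr k D) (@dscaleDl k D) (@dcompDl k D)
  (@dcompDr k D) (@dcompZl k D) (@dcompZr k D)
  (fun f f' g => dtensDr g f f') (fun f g g' => dtensDl g g' f)
  (fun z f g => dtensZr z g f) (fun z f g => dtensZl z g f)).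
- by move=> f g a b c d tf tg; exact: ty_tens.
- by move=> f g f' g' a b c tf tg; exact: dinterr tf tg.
- by move=> f g f' g' a b c tf tg; exact: dinterl tf tg.
Defined.

End Mirror.

Section Squares.
Variables (k : fieldType) (D : diagalg k) (thk : nat -> dob D)
  (mg sp cr : nat -> nat -> D).
(** The square on the right-hand side of (W2), where s and t are the
thicknesses of the outer strands, and i and j those of the two strands which
cross: a morphism from (s + i) ⊗ (j + t) to (s + j) ⊗ (i + t). *)
Definition sqr (s t i j : nat) : D :=
  (mg s j ⊠ mg i t) • (did (thk s) ⊠ cr i j ⊠ did (thk t)) • (sp s i ⊠ sp j t).
End Squares.

(** A diagram algebra with merges, splits and crossings of all thicknesses,
subject to (W1), (W2) and (W3).  Strands of thickness 0 are allowed, with the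
convention that they are invisible; this removes all positivity conditions.
The sum in (W2) has one free index; [wswitchl] and [wswitchr] are the two cases
s = t + e and t = s + e, with the term of lowest index set apart.  The scalars of
(W3) may be arbitrary nonzero ones. *)
Record webalg (k : fieldType) (q : k) := WebAlg {
  walg :> diagalg k;
  wthk : nat -> dob walg;
  wm : nat -> nat -> walg;
  ws : nat -> nat -> walg;
  wc : nat -> nat -> walg;
  wbin : nat -> nat -> k;
  wthk0 : wthk 0 = dnil walg;
  ty_m : forall a b, dty (wm a b) (dcat (wthk a) (wthk b)) (wthk (a + b));
  ty_s : forall a b, dty (ws a b) (wthk (a + b)) (dcat (wthk a) (wthk b));
  ty_c : forall a b,
    dty (wc a b) (dcat (wthk a) (wthk b)) (dcat (wthk b) (wthk a));
  wm0s : forall a, wm 0 a = did (wthk a);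
  wms0 : forall a, wm a 0 = did (wthk a);
  ws0s : forall a, ws 0 a = did (wthk a);
  wss0 : forall a, ws a 0 = did (wthk a);
  wc0s : forall a, wc 0 a = did (wthk a);
  wcs0 : forall a, wc a 0 = did (wthk a);
  wmA : forall a b c,
    wm (a + b) c • (wm a b ⊠ did (wthk c)) =
    wm a (b + c) • (did (wthk a) ⊠ wm b c);
  wsA : forall a b c,
    (ws a b ⊠ did (wthk c)) • ws (a + b) c =
    (did (wthk a) ⊠ ws b c) • ws a (b + c);
  wswitchl : forall e c d,
    ws (c + e) d • wm (d + e) c =
    usum (sqr wthk wm ws wc e 0 d c) (minn d c) (fun t =>
      q ^+ ((t.+1 + e) * t.+1) ⋅
      sqr wthk wm ws wc (t.+1 + e) t.+1 (d - t.+1) (c - t.+1));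
  wswitchr : forall e a b,
    ws b (a + e) • wm a (b + e) =
    usum (sqr wthk wm ws wc 0 e a b) (minn a b) (fun s =>
      q ^+ (s.+1 * (s.+1 + e)) ⋅
      sqr wthk wm ws wc s.+1 (s.+1 + e) (a - s.+1) (b - s.+1));
  wbub : forall a b, wm a b • ws a b = wbin a b ⋅ did (wthk (a + b));
  wbin_neq0 : forall a b, wbin a b != 0
}.
Arguments wthk {k q w} n.
Arguments wm {k q w} a b.
Arguments ws {k q w} a b.
Arguments wc {k q w} a b.

Section MirrorWeb.
Variables (k : fieldType) (q : k) (W : webalg q).

(** Reflection exchanges the two forms of (W2) and reverses the indices of
merges, splits and crossings. *)
Definition mirror_web : webalg q.
Proof.
refine (@WebAlg k q (mirror_alg W) (@wthk k q W) (fun a b => wm b a)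
  (fun a b => ws b a) (fun a b => wc b a) (fun a b => wbin W b a)
  (wthk0 W) _ _ _ (@wms0 _ _ W) (@wm0s _ _ W) (@wss0 _ _ W) (@ws0s _ _ W)
  (@wcs0 _ _ W) (@wc0s _ _ W) _ _ _ _ _ (fun a b => wbin_neq0 W b a)).
- by move=> a b /=; rewrite addnC; exact: ty_m.
- by move=> a b /=; rewrite addnC; exact: ty_s.
- by move=> a b /=; exact: ty_c.
- by move=> a b c /=; rewrite addnC -wmA addnC.
- by move=> a b c /=; rewrite addnC -wsA addnC.
- move=> e c d /=; rewrite wswitchr minnC /=.
  apply: (etrans _ (eq_usum _ _)); last first.
    by move=> i _; rewrite mulnC.
  rewrite /sqr /= !dtensA; elim: (minn _ _) => //= n <-.
  by rewrite !dtensA.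
- move=> e a b /=; rewrite wswitchl minnC /=.
  apply: (etrans _ (eq_usum _ _)); last first.
    by move=> i _; rewrite mulnC.
  rewrite /sqr /= !dtensA; elim: (minn _ _) => //= n <-.
  by rewrite !dtensA.
- by move=> a b /=; rewrite wbub addnC.
Defined.

End MirrorWeb.

(** * Typing and interchange *)

(** Equality of objects, up to associativity and arithmetic on thicknesses. *)
Ltac objeq := first [reflexivity | rewrite /= ?wthk0 ?dcat0s ?dcats0 ?dcatA ?addn0 ?add0n;
  repeat first [reflexivity | apply: (f_equal2 dcat) | apply: (f_equal wthk)];
  lia].

Lemma ty_eq (k : fieldType) (D : diagalg k) (f : D) a b a' b' :
  dty f a b -> a = a' -> b = b' -> dty f a' b'.
Proof. by move=> h <- <-. Qed.

(** Synthesizes source and target from the shape of a diagram; variables are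
looked up among the hypotheses. *)
Ltac tyinfer := match goal with
  | |- dty (dcomp _ _) _ _ =>
      eapply ty_comp; [tyinfer | eapply ty_eq; [tyinfer | reflexivity | objeq]]
  | |- dty (dtens _ _) _ _ => eapply ty_tens; [tyinfer | tyinfer]
  | |- dty (did _) _ _ => eapply ty_id
  | |- dty (wm _ _) _ _ => eapply ty_m
  | |- dty (ws _ _) _ _ => eapply ty_s
  | |- dty (wc _ _) _ _ => eapply ty_c
  | |- dty (dscale _ _) _ _ => eapply ty_scale; tyinfer
  | |- dty (dadd _ _) _ _ =>
      eapply ty_add; [tyinfer | eapply ty_eq; [tyinfer | objeq | objeq]]
  | H : dty ?x _ _ |- dty ?x _ _ => eapply H
  end.
(** Proves [dty f a b], where b may be an existential variable. *)
Ltac ty := eapply ty_eq; [tyinfer | objeq | objeq].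

Section Typed.
Variables (k : fieldType) (D : diagalg k).
Implicit Types (f g : D).

(** Half of the typing information, as required by the unit and interchange
laws. *)
Definition starts f a := exists b, dty f a b.
Definition ends f b := exists a, dty f a b.
Definition composable f g := exists b, starts f b /\ ends g b.

Lemma compm1 f a : starts f a -> f • did a = f.
Proof. by case=> b; exact: dcompm1. Qed.

Lemma comp1m f b : ends f b -> did b • f = f.
Proof. by case=> a; exact: dcomp1m. Qed.

Lemma interl f g f' g' : composable f g ->
  (f ⊠ f') • (g ⊠ g') = (f • g) ⊠ (f' • g').
Proof. by case=> b [[c tf] [a tg]]; exact: dinterl tf tg. Qed.

Lemma interr f g f' g' : composable f' g' ->
  (f ⊠ f') • (g ⊠ g') = (f • g) ⊠ (f' • g').
Proof. by case=> b [[c tf] [a tg]]; exact: dinterr tf tg. Qed.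

Lemma inter_id a f g : (did a ⊠ f) • (did a ⊠ g) = did a ⊠ (f • g).
Proof. by rewrite (dinterl _ _ (ty_id _) (ty_id _)) (dcomp1m (ty_id _)). Qed.

Lemma inter_di a f g : (f ⊠ did a) • (g ⊠ did a) = (f • g) ⊠ did a.
Proof. by rewrite (dinterr _ _ (ty_id _) (ty_id _)) (dcomp1m (ty_id _)). Qed.

Lemma tens_compl f g h a : starts h a -> (f • g) ⊠ h = (f ⊠ h) • (g ⊠ did a).
Proof.
move=> [b th]; rewrite interr ?(dcompm1 th) //.
by exists a; split; [exists b | exists a; exact: ty_id].
Qed.

Lemma tens_compr f g h a : starts h a -> h ⊠ (f • g) = (h ⊠ f) • (did a ⊠ g).
Proof.
move=> [b th]; rewrite interl ?(dcompm1 th) //.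
by exists a; split; [exists b | exists a; exact: ty_id].
Qed.

(** Morphisms acting on disjoint sets of strands commute. *)
Lemma far f g a b c d : dty f a b -> dty g c d ->
  (f ⊠ did d) • (did a ⊠ g) = (did b ⊠ g) • (f ⊠ did c).
Proof.
move=> tf tg; rewrite (dinterl _ _ tf (ty_id _)) (dcompm1 tf) (dcomp1m tg).
by rewrite (dinterl _ _ (ty_id _) tf) (dcomp1m tf) (dcompm1 tg).
Qed.

End Typed.

(** Solves typing conditions, including the existential ones above. *)
Ltac tys := first [ty | eexists; ty | eexists; split; eexists; ty].

(** * Splits slide through crossings *)

Section Sliding.
Variables (k : fieldType) (q : k).

Section Shapes.
Variable W : webalg q.
Local Notation I a := (did (wthk a) : W).
Local Notation m := (@wm _ _ W).
Local Notation s := (@ws _ _ W).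
Local Notation c := (@wc _ _ W).
Local Notation sq := (sqr wthk m s c).

(** Sliding of a split that cuts off the leftmost unit strand. *)
Definition slideL (a b : nat) :=
  (I b ⊠ s 1 a) • c a.+1 b = (c 1 b ⊠ I a) • (I 1 ⊠ c a b) • (s 1 a ⊠ I b).
(** The mirror image of [slideL a b]. *)
Definition slideR (a b : nat) :=
  (s a 1 ⊠ I b) • c b a.+1 = (I a ⊠ c b 1) • (c b a ⊠ I 1) • (I b ⊠ s a 1).

Lemma sqr0 a b : sq 0 0 a b = c a b.
Proof.
rewrite /sqr !wm0s !wms0 !ws0s !wss0 wthk0 dtens1m dtensm1 !dtens_id.
by rewrite compm1 ?comp1m; tys.
Qed.

(** A square of outer thicknesses t, in which a unit strand is split off the
thick strand that crosses from left to right, and leaves between the two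
outputs. *)
Definition strandl t i j : W :=
  (m t j ⊠ I 1 ⊠ m i t) •
  (I t ⊠ ((c 1 j ⊠ I i) • (I 1 ⊠ c i j) • (s 1 i ⊠ I j)) ⊠ I t) •
  (s t i.+1 ⊠ s j t).

(** For t = 0 this is the right-hand side of [slideL]. *)
Lemma strandl0 i j :
  strandl 0 i j = (c 1 j ⊠ I i) • (I 1 ⊠ c i j) • (s 1 i ⊠ I j).
Proof.
rewrite /strandl wm0s wms0 ws0s wss0 wthk0 dtens1m dtensm1 !dtens_id.
by rewrite compm1 ?comp1m; tys.
Qed.
(** The analogous square with outer thicknesses u + 1 and u, in which the unit
strand comes from the strand that crosses from right to left. *)
Definition strandr u i j : W :=
  (m u.+1 j ⊠ I 1 ⊠ m i u) •
  (I u.+1 ⊠ ((I j ⊠ c i 1) • (c i j ⊠ I 1) • (I i ⊠ s j 1)) ⊠ I u) •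
  (s u.+1 i ⊠ s j.+1 u).

(** The next four lemmas move a split below the merges of a square.  Cutting a
unit strand off the left output (cutl) or off the right output (cutr) of a
square produces, by (W2) for the split of the merge, a smaller square in the
place of that merge; the middle of the diagram is then simplified by
coassociativity, far commutation and a smaller sliding relation. *)
Lemma cutl_strandl t i j :
  (sq t 0 1 j ⊠ m i t) • (I t.+1 ⊠ c i j ⊠ I t) • (s t.+1 i ⊠ s j t) =
  strandl t i j.
Proof.
rewrite /sqr /strandl wms0 wss0 wthk0 dtensm1.
rewrite (@tens_compl _ _ _ _ _ (dcat (wthk i) (wthk t))); last by tys.
rewrite -!inter_di -!inter_id -!dtens_id !dtensA !dcompA; congr (_ • _).
congr (_ • _).
have := @far _ W (s t 1) (c i j ⊠ I t) (wthk t.+1) (dcat (wthk t) (wthk 1))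
  (dcat (wthk i) (dcat (wthk j) (wthk t))) (dcat (wthk j) (dcat (wthk i) (wthk t))).
rewrite -!dtens_id !dtensA -dcompA => ->; [|ty|ty].
rewrite dcompA; congr (_ • _).
rewrite -dtensA interl; last by tys.
have := wsA W t 1 i; rewrite addn1 add1n => ->.
rewrite -(@interl _ W); last by tys.
by rewrite dtensA.
Qed.

Lemma cutl_strandr u i j : slideR j i ->
  (sq u.+1 1 0 j ⊠ m i u) • (I u.+1 ⊠ c i j.+1 ⊠ I u) • (s u.+1 i ⊠ s j.+1 u) =
  strandr u i j.
Proof.
move=> h; rewrite /sqr /strandr wm0s wss0 wc0s -h.
rewrite (@tens_compl _ _ _ _ _ (dcat (wthk i) (wthk u))); last by tys.
rewrite !dcompA !dtensA; congr (_ • _).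
rewrite !dtens_id comp1m -?dtens_id; last by tys.
by rewrite -inter_di -inter_id !dtensA dcompA.
Qed.

Lemma cutr_strandr u i j :
  (m u.+1 j ⊠ sq 0 u i 1) • (I u.+1 ⊠ c i j ⊠ I u.+1) • (s u.+1 i ⊠ s j u.+1) =
  strandr u i j.
Proof.
rewrite /sqr /strandr wm0s ws0s wthk0 dtens1m.
rewrite (@tens_compr _ _ _ _ _ (dcat (wthk u.+1) (wthk j))); last by tys.
rewrite !dcompA; congr (_ • _).
rewrite -!dtens_id !dtensA -!inter_id -!inter_di -!inter_id !dtensA !dcompA.
congr (_ • _).
have := @far _ W (c i j) (s 1 u) (dcat (wthk i) (wthk j))
  (dcat (wthk j) (wthk i)) (wthk u.+1) (dcat (wthk 1) (wthk u)).
rewrite -!dtens_id !dtensA => h.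
rewrite -dcompA inter_id -h; [|ty|ty].
rewrite -inter_id dcompA; congr (_ • _).
rewrite -dtensA interr; last by tys.
have := wsA W j 1 u; rewrite addn1 add1n => <-.
rewrite -(@interr _ W); last by tys.
by rewrite !dtensA.
Qed.

Lemma cutr_strandl u i j : slideL i j ->
  (m u.+1 j ⊠ sq 1 u.+1 i 0) • (I u.+1 ⊠ c i.+1 j ⊠ I u.+1) •
  (s u.+1 i.+1 ⊠ s j u.+1) = strandl u.+1 i j.
Proof.
move=> h; rewrite /sqr /strandl wms0 ws0s wcs0 -h.
rewrite (@tens_compr _ _ _ _ _ (dcat (wthk u.+1) (wthk j))); last by tys.
rewrite !dcompA; congr (_ • _).
rewrite !dtens_id comp1m -?dtens_id; last by tys.
by rewrite -inter_di -inter_id !dtensA dcompA.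
Qed.

(** A split on the left output of a square: the two terms of (W2), of which the
second one exists only for j > 0. *)
Lemma cutl_sqr t i j : ((0 < j)%N -> slideR j.-1 i) ->
  (s (j + t) 1 ⊠ I (i + t)) • sq t.+1 t i j =
  cadd (0 < j)%N (strandl t i j) (q ^+ t.+1 ⋅ strandr t i j.-1).
Proof.
move=> h; rewrite {1}/sqr -dcompA interl; last by tys.
rewrite comp1m; last by tys.
have -> : s (j + t) 1 • m t.+1 j = _ := wswitchl W t j 1.
case: j h => [|j] h; first by rewrite minn0; exact: cutl_strandl.
rewrite minnSS min0n /= dtensDl dcompDl dtensZl dcompZl.
rewrite !subSS !subn0 muln1 add1n; congr (_ ⊞ _ ⋅ _); first exact: cutl_strandl.
by apply: cutl_strandr; exact: h.
Qed.

Lemma cutr_sqr u i j : ((0 < i)%N -> slideL i.-1 j) ->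
  (I (j + u.+1) ⊠ s 1 (i + u)) • sq u.+1 u.+1 i j =
  cadd (0 < i)%N (strandr u i j) (q ^+ u.+1 ⋅ strandl u.+1 i.-1 j).
Proof.
move=> h; rewrite {1}/sqr -dcompA interl; last by tys.
rewrite comp1m; last by tys.
have -> : s 1 (i + u) • m i u.+1 = _ := wswitchr W u i 1.
case: i h => [|i] h; first by rewrite min0n; exact: cutr_strandr.
rewrite minnSS minn0 /= dtensDr dcompDl dtensZr dcompZl.
rewrite !subSS !subn0 mul1n add1n; congr (_ ⊞ _ ⋅ _); first exact: cutr_strandr.
by apply: cutr_strandl; exact: h.
Qed.

(** The induction step: both sides of the coassociativity relation
(s_{b,1} ⊗ 1) s_{b+1,a} = (1 ⊗ s_{1,a}) s_{b,a+1}, composed with m_{a+1,b}, are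
expanded into the two sides of [slideL a b] plus the same sums. *)
Lemma slideL_step a b :
  (forall i j, (i + j < a + b)%N -> slideL i j) ->
  (forall i j, (i + j < a + b)%N -> slideR i j) ->
  slideL a b.
Proof.
move=> hL hR; rewrite /slideL -strandl0.
pose Q u := q ^+ (u.+1 * u.+1) ⋅ strandr u (a - u) (b - u.+1).
pose R u := q ^+ (u.+1 * u.+2) ⋅ strandl u.+1 (a - u.+1) (b - u.+1).
(* R is shifted by one: strandl 0 is the right-hand side of the goal. *)
have e1 : (s b 1 ⊠ I a) • (s (b + 1) a • m (a + 1) b) =
    usum (cadd (0 < b)%N (strandl 0 a b) (Q 0)) (minn a b)
         (fun t => cadd (t < b.-1)%N (R t) (Q t.+1)).
  rewrite wswitchl comp_usumr.
  have -> : (s b 1 ⊠ I a) • sq 1 0 a b =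
            cadd (0 < b)%N (strandl 0 a b) (Q 0).
    have := @cutl_sqr 0 a b; rewrite !addn0 /Q subn0 subn1 mul1n; apply=> hb.
    by apply: hR; lia.
  apply: eq_usum => t ht; rewrite dcompZr addn1.
  have -> : (t < b.-1)%N = (0 < b - t.+1)%N by lia.
  have := @cutl_sqr t.+1 (a - t.+1) (b - t.+1).
  rewrite !subnK; [|lia|lia] => ->; last by move=> ?; apply: hR; lia.
  rewrite caddZ dscaleA -exprD -subn1 -subnDA addn1 /Q /R.
  by congr (cadd _ (_ ^+ _ ⋅ _) (_ ^+ _ ⋅ _)); lia.
have e2 : (I b ⊠ s 1 a) • (s b a.+1 • m a.+1 b) =
    usum ((I b ⊠ s 1 a) • c a.+1 b) (minn a.+1 b)
         (fun u => cadd (u < a)%N (Q u) (R u)).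
  have := wswitchl W 0 b a.+1; rewrite !addn0 sqr0 => ->; rewrite comp_usumr.
  apply: eq_usum => u hu; rewrite dcompZr addn0 subSS.
  have -> : (u < a)%N = (0 < a - u)%N by lia.
  have := @cutr_sqr u (a - u) (b - u.+1).
  rewrite !subnK; [|lia|lia] => ->; last by move=> ?; apply: hL; lia.
  rewrite caddZ dscaleA -exprD -subn1 -subnDA addn1 /Q /R.
  by congr (cadd _ (_ ^+ _ ⋅ _) (_ ^+ _ ⋅ _)); lia.
have e : (s b 1 ⊠ I a) • (s (b + 1) a • m (a + 1) b) =
         (I b ⊠ s 1 a) • (s b a.+1 • m a.+1 b).
  by rewrite -!dcompA wsA addn1 add1n.
(* Both sides are brought to the form z + (all the Q) + (all the R). *)
move: e; rewrite e1 e2 !usum_cadd.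
have -> : minn (minn a.+1 b) a = minn a b by lia.
rewrite usumC.
have -> : usum (cadd (0 < b)%N (strandl 0 a b) (Q 0)) (minn (minn a b) b.-1)
    (fun t => Q t.+1) = usum (strandl 0 a b) (minn a.+1 b) Q.
  case: (b) => [|b']; first by rewrite !minn0.
  by rewrite minnSS usum_recl /=; congr (usum _ _ _); lia.
have tR t i j : dty (strandl t i j) (dcat (wthk (t + i.+1)) (wthk (j + t)))
                  (dcat (wthk (t + j)) (dcat (wthk 1) (wthk (i + t)))).
  by rewrite /strandl; ty.
have tQ u i j : dty (strandr u i j) (dcat (wthk (u.+1 + i)) (wthk (j.+1 + u)))
                  (dcat (wthk (u.+1 + j)) (dcat (wthk 1) (wthk (i + u)))).
  by rewrite /strandr; ty.
have tr0 := tR 0 a b.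
have tl : dty ((I b ⊠ s 1 a) • c a.+1 b) (dcat (wthk (0 + a.+1)) (wthk (b + 0)))
              (dcat (wthk (0 + b)) (dcat (wthk 1) (wthk (a + 0)))) by ty.
have {}tR t : (t < minn a b)%N ->
    dty (R t) (dcat (wthk (0 + a.+1)) (wthk (b + 0)))
              (dcat (wthk (0 + b)) (dcat (wthk 1) (wthk (a + 0)))).
  by move=> ht; apply/ty_scale/(ty_eq (tR _ _ _)); objeq.
have {}tQ t : (t < minn a.+1 b)%N ->
    dty (Q t) (dcat (wthk (0 + a.+1)) (wthk (b + 0)))
              (dcat (wthk (0 + b)) (dcat (wthk 1) (wthk (a + 0)))).
  by move=> ht; apply/ty_scale/(ty_eq (tQ _ _ _)); objeq.
move/(usumI (ty_usum tr0 tQ) (ty_usum tl tQ) tR).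
by move/(usumI tr0 tl tQ)/esym.
Qed.

End Shapes.

Lemma slides n : forall (W : webalg q) a b, (a + b < n)%N ->
  slideL W a b /\ slideR W a b.
Proof.
elim: n => // n IH W a b hab; split.
  apply: slideL_step => i j h; first by apply: (proj1 (IH _ _ _ _)); lia.
  by apply: (proj2 (IH _ _ _ _)); lia.
(* slideR for W is, by computation, slideL for the mirror image of W. *)
apply: (@slideL_step (mirror_web W)) => i j h.
  by apply: (proj2 (IH W i j _)); lia.
by apply: (proj1 (IH W i j _)); lia.
Qed.
End Sliding.

(** * Dots on thick strands *)

Section Dots.
Variables (k : fieldType) (q : k) (W : webalg q).
Local Notation I a := (did (wthk a) : W).
Local Notation m := (@wm _ _ W).
Local Notation s := (@ws _ _ W).
Local Notation c := (@wc _ _ W).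
Local Notation sq := (sqr wthk m s c).

Lemma slide_splitl a b :
  (I b ⊠ s 1 a) • c a.+1 b = (c 1 b ⊠ I a) • (I 1 ⊠ c a b) • (s 1 a ⊠ I b).
Proof. exact: proj1 (slides W (ltnSn (a + b))). Qed.

Lemma bubble_whisker o o' a b : 
  (did o ⊠ m a b ⊠ did o') • (did o ⊠ s a b ⊠ did o') =
  wbin W a b ⋅ did (dcat o (dcat (wthk (a + b)) o')).
Proof.
by rewrite inter_id inter_di wbub dtensZl dtensZr !dtens_id.
Qed.

(** By (W3), splits are split monomorphisms, also between other strands. *)
Lemma split_mono o o' a b (f g : W) x :
  dty f x (dcat o (dcat (wthk (a + b)) o')) ->
  dty g x (dcat o (dcat (wthk (a + b)) o')) ->
  (did o ⊠ s a b ⊠ did o') • f = (did o ⊠ s a b ⊠ did o') • g -> f = g.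
Proof.
move=> tf tg /(congr1 (dcomp (did o ⊠ m a b ⊠ did o'))).
rewrite -!dcompA bubble_whisker !dcompZl (dcomp1m tf) (dcomp1m tg).
move/(congr1 (dscale (wbin W a b)^-1)).
by rewrite !dscaleA mulVf ?wbin_neq0 // !dscale1.
Qed.

Lemma merge_epi o o' a b (f g : W) x :
  dty f (dcat o (dcat (wthk (a + b)) o')) x ->
  dty g (dcat o (dcat (wthk (a + b)) o')) x ->
  f • (did o ⊠ m a b ⊠ did o') = g • (did o ⊠ m a b ⊠ did o') -> f = g.
Proof.
move=> tf tg /(congr1 (fun h => dcomp h (did o ⊠ s a b ⊠ did o'))).
rewrite !dcompA bubble_whisker !dcompZr (dcompm1 tf) (dcompm1 tg).
move/(congr1 (dscale (wbin W a b)^-1)).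
by rewrite !dscaleA mulVf ?wbin_neq0 // !dscale1.
Qed.

(** Sliding a split s_{1,r} of the upper left strand.  The mirror image of
[slide_splitl] is about s_{r,1} instead; both are linked by coassociativity. *)
Lemma slide_splitr r a :
  (s 1 r ⊠ I a) • c a r.+1 = (I 1 ⊠ c a r) • (c a 1 ⊠ I r) • (I a ⊠ s 1 r).
Proof.
have slR p b : (s p 1 ⊠ I b) • c b p.+1 =
    (I p ⊠ c b 1) • (c b p ⊠ I 1) • (I b ⊠ s p 1).
  exact: proj2 (slides W (ltnSn (p + b))).
elim: r => [|r IH].
  rewrite wss0 wcs0 wthk0 dtensm1 !dtens_id comp1m; last by tys.
  by rewrite comp1m ?compm1 //; tys.
apply: (@split_mono (wthk 1) (wthk a) r 1); [ty|ty|].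
have h : (I 1 ⊠ s r 1) • s 1 r.+1 = (s 1 r ⊠ I 1) • s r.+1 1.
  by have := wsA W 1 r 1; rewrite addn1 add1n => ->.
rewrite -dcompA -!dtensA inter_di h -inter_di dcompA slR !dtensA.
have := @far _ W (s 1 r) (c a 1) (wthk r.+1) (dcat (wthk 1) (wthk r))
  (dcat (wthk a) (wthk 1)) (dcat (wthk 1) (wthk a)).
rewrite -!dtens_id !dtensA -dcompA => ->; [|ty|ty].
rewrite dcompA -[in LHS]dtensA -[X in _ • X]dcompA.
rewrite -(dtensA (s 1 r)) inter_di IH.
rewrite -[in RHS]dcompA inter_id slR -!inter_id !dcompA -!inter_di !dtensA !dcompA.
congr (_ • _); congr (_ • _).
have := @far _ W (c a 1) (s r 1) (dcat (wthk a) (wthk 1))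
  (dcat (wthk 1) (wthk a)) (wthk r.+1) (dcat (wthk r) (wthk 1)).
rewrite -!dtens_id !dtensA => far2.
rewrite -[in RHS]dcompA -far2; [|ty|ty].
by rewrite dcompA !inter_id h.
Qed.

(** The square without crossing strands. *)
Lemma sqr_id i j : sq i j 0 0 = did (dcat (wthk i) (wthk j)).
Proof.
rewrite /sqr wcs0 wms0 wss0 wm0s ws0s wthk0 dtens1m !dtens_id.
by rewrite !(@comp1m _ W); tys.
Qed.

Section Dot.
Variable y : W.
Hypothesis ty_y : dty y (wthk 1) (wthk 1).
Hypothesis y_cross : (y ⊠ y) • c 1 1 = c 1 1 • (y ⊠ y).

(** The thick dots built from a unit dot y, by
y_{n+1} = w^-1 m_{1,n} (y ⊗ y_n) s_{1,n}, where w is the scalar m_{1,n} s_{1,n}. *)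
Fixpoint dots n : W :=
  if n is n'.+1 then (wbin W 1 n')^-1 ⋅ (m 1 n' • (y ⊠ dots n') • s 1 n') else I 0.

Lemma ty_dots n : dty (dots n) (wthk n) (wthk n).
Proof. elim: n => [|n IH] /=; [exact: ty_id | ty]. Qed.

Lemma bubble1 n : m 1 n • s 1 n = wbin W 1 n ⋅ I n.+1.
Proof. exact: wbub. Qed.

(** If y ⊗ y_n commutes with s_{1,n} m_{1,n}, then y_{n+1} passes through
s_{1,n} and m_{1,n}. *)
Lemma dots_commute n : (y ⊠ dots n) • (s 1 n • m 1 n) =
    (s 1 n • m 1 n) • (y ⊠ dots n) ->
  s 1 n • dots n.+1 = (y ⊠ dots n) • s 1 n /\
  dots n.+1 • m 1 n = m 1 n • (y ⊠ dots n).
Proof.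
have td := ty_dots n.
move=> h; split; rewrite /= ?dcompZr ?dcompZl.
  rewrite -(dcompA (s 1 n)) -(dcompA (s 1 n • m 1 n)) -h.
  rewrite !dcompA bubble1 !dcompZr compm1; last by tys.
  by rewrite dscaleA mulVf ?wbin_neq0 // dscale1.
rewrite !dcompA h -!dcompA bubble1 !dcompZl comp1m; last by tys.
by rewrite dscaleA mulVf ?wbin_neq0 // dscale1.
Qed.

Lemma dots1 n : s 1 n • dots n.+1 = (y ⊠ dots n) • s 1 n /\
  dots n.+1 • m 1 n = m 1 n • (y ⊠ dots n).
Proof.
elim: n => [|n [IHs IHm]]; apply: dots_commute.
  rewrite wss0 wms0 /= wthk0 dtensm1.
  by rewrite comp1m ?compm1 ?comp1m //; tys.
have td := ty_dots n; have td' := ty_dots n.+1.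
rewrite (wswitchr W n 1 1 : s 1 n.+1 • m 1 n.+1 = _) minnn.
rewrite [usum _ _ _]/= !dcompDl !dcompDr !dcompZl !dcompZr; congr (_ ⊞ _ ⋅ _).
  rewrite /sqr wm0s ws0s wthk0 dtens1m !dcompA.
  have em : (y ⊠ dots n.+1) • (I 1 ⊠ m 1 n) = (I 1 ⊠ m 1 n) • (y ⊠ y) ⊠ dots n.
    rewrite dtensA !(@interl _ W); try tys.
    by rewrite IHm compm1 ?comp1m //; tys.
  have es : (I 1 ⊠ s 1 n) • (y ⊠ dots n.+1) = (y ⊠ y) ⊠ dots n • (I 1 ⊠ s 1 n).
    rewrite dtensA !(@interl _ W); try tys.
    by rewrite IHs compm1 ?comp1m //; tys.
  have ec : (y ⊠ y) ⊠ dots n • (c 1 1 ⊠ I n) = (c 1 1 ⊠ I n) • (y ⊠ y) ⊠ dots n.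
    rewrite !(@interl _ W); try tys.
    by rewrite y_cross compm1 ?comp1m //; tys.
  by rewrite es -dcompA em dcompA -(dcompA ((y ⊠ y) ⊠ _)) ec !dcompA.
rewrite subnn sqr_id add1n.
by rewrite comp1m ?compm1 //; tys.
Qed.

(** Relation (W5), by induction on a below the monomorphism
s_{1,a} ⊗ 1_b. *)
Lemma split_dots a b : s a b • dots (a + b) = (dots a ⊠ dots b) • s a b.
Proof.
elim: a b => [|a IH] b.
  by rewrite ws0s /= wthk0 dtens1m; have td := ty_dots b;
    rewrite comp1m ?compm1 //; tys.
have := ty_dots (a.+1 + b); have := ty_dots a.+1; have := ty_dots b => t1 t2 t3.
have := ty_dots a; have := ty_dots (a + b) => t4 t5.
apply: (@split_mono (dnil W) (wthk b) 1 a); [ty|ty|rewrite !dtens1m].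
have e : (s 1 a ⊠ I b) • s a.+1 b = (I 1 ⊠ s a b) • s 1 (a + b).
  by have := wsA W 1 a b; rewrite add1n.
have [e1 _] := dots1 (a + b); rewrite -addSn in e1.
rewrite -dcompA e dcompA e1 -dcompA interr; last by tys.
rewrite IH comp1m; last by tys.
rewrite -[X in X ⊠ _ • _](compm1 (a := wthk 1)); last by tys.
rewrite -(@interl _ W y); last by tys.
rewrite dcompA -e -[in RHS]dcompA -[in LHS]dcompA; congr (_ • _).
rewrite -dtensA !(@interl _ W); try tys.
by rewrite (proj1 (dots1 a)) comp1m ?compm1 //; tys.
Qed.

Lemma merge_dots a b : dots (a + b) • m a b = m a b • (dots a ⊠ dots b).
Proof.
elim: a b => [|a IH] b.
  by rewrite wm0s /= wthk0 dtens1m; have td := ty_dots b;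
    rewrite comp1m ?compm1 //; tys.
have := ty_dots (a.+1 + b); have := ty_dots a.+1; have := ty_dots b => t1 t2 t3.
have := ty_dots a; have := ty_dots (a + b) => t4 t5.
apply: (@merge_epi (dnil W) (wthk b) 1 a); [ty|ty|rewrite !dtens1m].
have e : m a.+1 b • (m 1 a ⊠ I b) = m 1 (a + b) • (I 1 ⊠ m a b).
  by have := wmA W 1 a b; rewrite add1n.
have [_ e1] := dots1 (a + b); rewrite -addSn in e1.
rewrite dcompA e -dcompA e1 dcompA interr; last by tys.
rewrite IH compm1; last by tys.
rewrite -[X in _ • (X ⊠ _)](comp1m (b := wthk 1)); last by tys.
rewrite -(@interl _ W (I 1)); last by tys.
rewrite -dcompA -e [in LHS]dcompA [in RHS]dcompA; congr (_ • _).
rewrite -dtensA !(@interl _ W); try tys.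
by rewrite (proj2 (dots1 a)) comp1m ?compm1 //; tys.
Qed.

End Dot.

Lemma dots_inv y z n : dty y (wthk 1) (wthk 1) -> dty z (wthk 1) (wthk 1) ->
  (y ⊠ y) • c 1 1 = c 1 1 • (y ⊠ y) -> (z ⊠ z) • c 1 1 = c 1 1 • (z ⊠ z) ->
  y • z = I 1 -> dots y n • dots z n = I n.
Proof.
move=> ty_y ty_z cy cz yz; elim: n => [|n IH] /=.
  by rewrite comp1m //; tys.
have := ty_dots ty_y n.+1; have := ty_dots ty_z n.+1.
have := ty_dots ty_y n; have := ty_dots ty_z n => t1 t2 t3 t4.
apply: (@split_mono (dnil W) (dnil W) 1 n); [ty|ty|rewrite !dtens1m !dtensm1].
rewrite -dcompA (proj1 (dots1 ty_y cy n)) dcompA (proj1 (dots1 ty_z cz n)).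
rewrite -dcompA interl; last by tys.
by rewrite yz IH !dtens_id comp1m ?compm1 //; tys.
Qed.

Section Cross.
Variable x : W.
Hypothesis ty_x : dty x (wthk 1) (wthk 1).
Hypothesis x_comm : (x ⊠ x) • c 1 1 = c 1 1 • (x ⊠ x).
Hypothesis x_cross : c 1 1 • (x ⊠ I 1) • c 1 1 = I 1 ⊠ x.

Lemma dot1_cross b : c 1 b • (x ⊠ I b) • c b 1 = I b ⊠ x.
Proof.
elim: b => [|b IH].
  by rewrite wc0s wcs0 wthk0 dtens1m dtensm1 comp1m ?compm1 //; tys.
apply: (@split_mono (dnil W) (wthk 1) 1 b); [ty|ty|rewrite !dtens1m].
rewrite -dcompA slide_splitr !dcompA.
have -> : (I 1 ⊠ s 1 b) • (x ⊠ I b.+1) • c b.+1 1 =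
          (x ⊠ I 1 ⊠ I b) • (I 1 ⊠ s 1 b) • c b.+1 1.
  rewrite -!dcompA; congr (_ • _); rewrite dtens_id.
  by rewrite !(@interl _ W); try tys; rewrite comp1m ?compm1 ?comp1m ?compm1 //; tys.
rewrite slide_splitl.
have -> Z : (c 1 1 ⊠ I b) • (x ⊠ I 1 ⊠ I b) • (c 1 1 ⊠ I b) • Z =
          (I 1 ⊠ x ⊠ I b) • Z.
  by rewrite -!dcompA -[x ⊠ _]dtensA !inter_di dcompA x_cross dtensA.
have -> Z : (I 1 ⊠ c 1 b) • (I 1 ⊠ x ⊠ I b) • (I 1 ⊠ c b 1) • Z =
          (I 1 ⊠ I b ⊠ x) • Z.
  by rewrite -!dcompA !inter_id dcompA IH.
rewrite -dtensA dtens_id !(@interr _ W); try tys.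
by rewrite comp1m ?compm1 ?comp1m ?compm1 //; tys.
Qed.

Local Notation X := (dots x).

Lemma dots_cross a b : c a b • (X a ⊠ I b) • c b a = I b ⊠ X a.
Proof.
elim: a => [|a IH].
  by rewrite wc0s wcs0 /= wthk0 dtens1m dtensm1 !(@comp1m _ W) //; tys.
have ta := ty_dots ty_x a; have ta1 := ty_dots ty_x a.+1.
apply: (@split_mono (wthk b) (dnil W) 1 a); [ty|ty|rewrite !dtensm1].
rewrite -dcompA slide_splitl !dcompA.
have -> : (s 1 a ⊠ I b) • (X a.+1 ⊠ I b) • c b a.+1 =
          (x ⊠ X a ⊠ I b) • (s 1 a ⊠ I b) • c b a.+1.
  by rewrite -!dcompA -dtensA !inter_di (proj1 (dots1 ty_x x_comm a)).
rewrite slide_splitr.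
have -> Z : (I 1 ⊠ c a b) • (x ⊠ X a ⊠ I b) • (I 1 ⊠ c b a) • Z =
            (x ⊠ I b ⊠ X a) • Z.
  rewrite -!dcompA !(@interl _ W); try tys.
  by rewrite -IH !dcompA comp1m ?compm1 //; tys.
have -> Z : (c 1 b ⊠ I a) • (x ⊠ I b ⊠ X a) • (c b 1 ⊠ I a) • Z =
            (I b ⊠ x ⊠ X a) • Z.
  rewrite -!dcompA -dtensA !(@interr _ W); try tys.
  by rewrite !dcompA dot1_cross comp1m ?compm1 ?dtensA //; tys.
by rewrite !inter_id (proj1 (dots1 ty_x x_comm a)).
Qed.

End Cross.
End Dots.

(** * The diagram algebra of a presentation *)

Section Untyped.
Variables (k : fieldType) (S : signature) (rel : term k S -> term k S -> Prop).
Local Notation T := (term k S).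
Local Notation eqv := (eqv rel).
Implicit Types (t u : T).

(** Equality in the presented category, extended to all terms by identifying the
ill-typed ones.  It is a congruence for all operations. *)
Definition ueqv t u : bool := `[< eqv t u \/ (~~ wt t) && (~~ wt u) >].

Lemma ueqvP t u : reflect (eqv t u \/ (~~ wt t) && (~~ wt u)) (ueqv t u).
Proof. exact: asboolP. Qed.

Lemma ueqv_refl : reflexive ueqv.
Proof.
move=> t; apply/ueqvP; case: (boolP (wt t)) => h; last by right.
by left; exact: EqvRefl.
Qed.

Lemma ueqv_sym : symmetric ueqv.
Proof.
by move=> t u; apply/ueqvP/ueqvP => -[/EqvSym|/andP[h1 h2]]; by [left|right; rewrite h1 h2].
Qed.

Lemma ueqv_trans : transitive ueqv.
Proof.
move=> u t v /ueqvP[h|/andP[h1 h2]] /ueqvP[h'|/andP[h1' h2']]; apply/ueqvP.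
- by left; exact: EqvTrans h'.
- by have [_ hu _] := eqv_typed h; rewrite hu in h1'.
- by have [hu _ _] := eqv_typed h'; rewrite hu in h2.
- by right; rewrite h1 h2'.
Qed.

Canonical ueqv_equiv := EquivRel ueqv ueqv_refl ueqv_sym ueqv_trans.

(** Terms modulo [ueqv], and the class of a term. *)
Definition umor := {eq_quot ueqv}.
HB.instance Definition _ := Choice.on umor.
Definition ucls (t : T) : umor := \pi_umor t.

Lemma ucls_eq t u : ucls t = ucls u <-> ueqv t u.
Proof. by split=> h; apply/eqmodP. Qed.

Lemma uclsP (P : umor -> Prop) : (forall t, P (ucls t)) -> forall x, P x.
Proof. by move=> h x; rewrite -[x]reprK; exact: h. Qed.

Lemma ueqv_repr t : ueqv (repr (ucls t)) t.
Proof. by apply/ucls_eq; rewrite /ucls reprK. Qed.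

Lemma ucls_eqv t u : wt t -> ucls t = ucls u -> eqv t u.
Proof. by move=> ht /ucls_eq/ueqvP[//|]; rewrite ht. Qed.

Lemma eqv_ucls t u : eqv t u -> ucls t = ucls u.
Proof. by move=> h; apply/ucls_eq/ueqvP; left. Qed.

Lemma typed_rel_eqv t u : rel t u ->
  (exists a b, typed a b t /\ typed a b u) -> eqv t u.
Proof.
move=> h [a [b [/and3P[w1 /eqP e1 /eqP e2] /and3P[w2 /eqP e3 /eqP e4]]]].
by apply: EqvRel => //; split; congruence.
Qed.

(** An axiom whose two sides are always either both ill typed or both well typed
and parallel holds for arbitrary terms. *)
Lemma ax_ucls t u : smc_axiom t u -> wt t = wt u ->
  (wt t -> parallel t u) -> ucls t = ucls u.
Proof.
move=> ax e p; apply/ucls_eq/ueqvP; case: (boolP (wt t)) => h.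
  by left; apply: EqvAx; rewrite -?e // ; exact: p.
by right; rewrite -e h.
Qed.

Lemma ueqv_comp f f' g g' : ueqv f f' -> ueqv g g' -> ueqv (Comp f g) (Comp f' g').
Proof.
move=> /ueqvP[h|/andP[/negbTE h1 /negbTE h2]]
  /ueqvP[h'|/andP[/negbTE h1' /negbTE h2']]; apply/ueqvP;
  try by right; rewrite /= ?h1 ?h2 ?h1' ?h2' ?andbF.
have [w1 w2 [p1 p2]] := eqv_typed h; have [w1' w2' [p1' p2']] := eqv_typed h'.
case: (eqVneq (src f) (tgt g)) => e; first by left; exact: EqvComp.
by right; rewrite /= w1 w2 w1' w2' -p1 -p2' (negbTE e).
Qed.

Lemma ueqv_tens f f' g g' : ueqv f f' -> ueqv g g' -> ueqv (Tens f g) (Tens f' g').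
Proof.
move=> /ueqvP[h|/andP[/negbTE h1 /negbTE h2]]
  /ueqvP[h'|/andP[/negbTE h1' /negbTE h2']]; apply/ueqvP;
  try by right; rewrite /= ?h1 ?h2 ?h1' ?h2' ?andbF.
by left; exact: EqvTens.
Qed.

Lemma ueqv_add f f' g g' : ueqv f f' -> ueqv g g' -> ueqv (Add f g) (Add f' g').
Proof.
move=> /ueqvP[h|/andP[/negbTE h1 /negbTE h2]]
  /ueqvP[h'|/andP[/negbTE h1' /negbTE h2']]; apply/ueqvP;
  try by right; rewrite /= ?h1 ?h2 ?h1' ?h2' ?andbF.
have [w1 w2 [p1 p2]] := eqv_typed h; have [w1' w2' [p1' p2']] := eqv_typed h'.
case: (boolP ((src f == src g) && (tgt f == tgt g))) => e.
  by left; apply: EqvAdd => //; case/andP: e => /eqP ? /eqP ?.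
by right; rewrite /= w1 w2 w1' w2' -p1 -p2 -p1' -p2' (negbTE e).
Qed.

Lemma ueqv_scale z f f' : ueqv f f' -> ueqv (Scale z f) (Scale z f').
Proof.
by move=> /ueqvP[h|h]; apply/ueqvP; [left; exact: EqvScale | right].
Qed.

Definition uid a : umor := ucls (Id a).
Definition ucomp (x y : umor) : umor := ucls (Comp (repr x) (repr y)).
Definition utens (x y : umor) : umor := ucls (Tens (repr x) (repr y)).
Definition uadd (x y : umor) : umor := ucls (Add (repr x) (repr y)).
Definition uscale z (x : umor) : umor := ucls (Scale z (repr x)).
Definition uty (x : umor) a b : Prop := typed a b (repr x).

Lemma ucompE t u : ucomp (ucls t) (ucls u) = ucls (Comp t u).
Proof. by apply/ucls_eq/ueqv_comp; exact: ueqv_repr. Qed.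
Lemma utensE t u : utens (ucls t) (ucls u) = ucls (Tens t u).
Proof. by apply/ucls_eq/ueqv_tens; exact: ueqv_repr. Qed.
Lemma uaddE t u : uadd (ucls t) (ucls u) = ucls (Add t u).
Proof. by apply/ucls_eq/ueqv_add; exact: ueqv_repr. Qed.
Lemma uscaleE z t : uscale z (ucls t) = ucls (Scale z t).
Proof. by apply/ucls_eq/ueqv_scale; exact: ueqv_repr. Qed.

Lemma utyE t a b : uty (ucls t) a b <-> typed a b t.
Proof.
have /ueqvP[/eqv_typed[h1 h2 [e1 e2]]|/andP[h1 h2]] := ueqv_repr t.
  by rewrite /uty /typed h1 h2 e1 e2.
by rewrite /uty /typed (negbTE h1) (negbTE h2).
Qed.

Definition uE := (ucompE, utensE, uaddE, uscaleE).

Lemma typedE a b t : typed a b t -> [/\ wt t, src t = a & tgt t = b].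
Proof. by case/and3P=> ? /eqP ? /eqP ?. Qed.

Lemma eqv_ax' t u : smc_axiom t u -> wt t -> wt u -> parallel t u -> ucls t = ucls u.
Proof. by move=> *; apply: eqv_ucls; exact: EqvAx. Qed.

Lemma eqseq_catr (A : eqType) (s1 s2 s3 : seq A) :
  (s1 ++ s3 == s2 ++ s3) = (s1 == s2).
Proof.
have rev_inj := can_inj (@revK A).
by rewrite -(inj_eq rev_inj) !rev_cat eqseq_cat // eqxx (inj_eq rev_inj).
Qed.

(** The diagram algebra of a presentation. *)
Definition untyped : diagalg k.
Proof.
refine (@DiagAlg k (seq (gob S)) [::] cat (@cat0s _) (@cats0 _)
  (fun a b c => esym (catA a b c)) umor uty uid ucomp utens uadd uscale
  _ _ _ _ _ _ _ _ _ _ _ _ _ _ _ _ _ _ _ _ _ _ _ _ _ _ _ _ _).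
- by move=> a; apply/utyE; exact: id_typed.
- elim/uclsP=> f; elim/uclsP=> g a b c; rewrite !uE !utyE; exact: comp_typed.
- elim/uclsP=> f; elim/uclsP=> g a b c d; rewrite !uE !utyE; exact: tens_typed.
- elim/uclsP=> f; elim/uclsP=> g a b; rewrite !uE !utyE; exact: add_typed.
- move=> z; elim/uclsP=> f a b; rewrite !uE !utyE; exact: scale_typed.
- elim/uclsP=> f; elim/uclsP=> g; elim/uclsP=> h; rewrite !uE.
  apply: ax_ucls; [exact: AxCompA | | by []].
  by rewrite /=; case: (wt f) (wt g) (wt h) (_ == _) (_ == _) => [] [] [] [] [].
- elim/uclsP=> f a b; rewrite /uid utyE !uE => /typedE[w _ <-].
  by apply: eqv_ax'; [exact: AxCompIdL | rewrite /= w eqxx | | ].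
- elim/uclsP=> f a b; rewrite /uid utyE !uE => /typedE[w <- _].
  by apply: eqv_ax'; [exact: AxCompIdR | rewrite /= w eqxx | | ].
- elim/uclsP=> f; elim/uclsP=> g; elim/uclsP=> h; rewrite !uE.
  by apply: ax_ucls; [exact: AxTensA | rewrite /= !andbA | rewrite /parallel /= !catA ].
- elim/uclsP=> f; rewrite !uE.
  by apply: ax_ucls; [exact: AxTensIdL | | ].
- elim/uclsP=> f; rewrite !uE.
  by apply: ax_ucls; [exact: AxTensIdR | rewrite /= andbT | rewrite /parallel /= !cats0 ].
- by move=> a b; rewrite /uid !uE; apply: ax_ucls; [exact: AxTensId | | ].
- elim/uclsP=> f; elim/uclsP=> g; elim/uclsP=> f'; elim/uclsP=> g' a b c.
  rewrite !uE !utyE => /typedE[wf sf tf] /typedE[wg sg tg].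
  apply: ax_ucls; [exact: AxTensComp | | by []].
  rewrite /= wf wg sf tg eqxx /= eqseq_cat // eqxx.
  by case: (wt f') (wt g') (_ == _) => [] [] [].
- elim/uclsP=> f; elim/uclsP=> g; elim/uclsP=> f'; elim/uclsP=> g' a b c.
  rewrite !uE !utyE => /typedE[wf sf tf] /typedE[wg sg tg].
  apply: ax_ucls; [exact: AxTensComp | | by []].
  rewrite /= wf wg sf tg eqxx /= eqseq_catr !andbT.
  by case: (wt f) (wt g) (_ == _) => [] [] [].
- elim/uclsP=> f; elim/uclsP=> g; elim/uclsP=> h; rewrite !uE.
  apply: ax_ucls; [exact: AxAddA | | by []].
  rewrite /=; case: (wt f) (wt g) (wt h) => [] [] []; rewrite /= ?andbF //.
  case: (eqVneq (src f) (src g)) => [->|_]; rewrite /= ?andbF //.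
  case: (eqVneq (tgt f) (tgt g)) => [->|_]; rewrite /= ?andbF //.
  by rewrite andbT.
- elim/uclsP=> f; elim/uclsP=> g; rewrite !uE.
  apply: ax_ucls; [exact: AxAddC | | ].
    rewrite /= (eq_sym (src f)) (eq_sym (tgt f)).
    by case: (wt f) (wt g) => [] [].
  by case/and4P=> _ _ /eqP e1 /eqP e2; split.
- elim/uclsP=> f; elim/uclsP=> g a b; rewrite !uE !utyE.
  move=> /typedE[wf sf tf] /typedE[wg sg tg].
  have -> : ucls (Add (Scale 0 f) g) = ucls (Add (Zero (src g) (tgt g)) g).
    apply: eqv_ucls; apply: EqvAdd; rewrite /parallel /= ?sf ?tf ?sg ?tg //.
      rewrite -sf -tf; apply: EqvAx; rewrite /parallel //; exact: AxScale0.
    exact: EqvRefl.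
  by apply: ax_ucls; [exact: AxAdd0 | rewrite /= wg !eqxx | ].
- by elim/uclsP=> f; rewrite !uE; apply: ax_ucls; [exact: AxScale1 | | ].
- by move=> z z'; elim/uclsP=> f; rewrite !uE; apply: ax_ucls; [exact: AxScaleA | | ].
- by move=> z; elim/uclsP=> f; elim/uclsP=> g; rewrite !uE;
    apply: ax_ucls; [exact: AxScaleDr | | ].
- move=> z z'; elim/uclsP=> f; rewrite !uE.
  by apply: ax_ucls; [exact: AxScaleDl | rewrite /= !eqxx !andbT andbb | ].
- elim/uclsP=> f; elim/uclsP=> f'; elim/uclsP=> g; rewrite !uE.
  apply: ax_ucls; [exact: AxCompDl | | by []].
  rewrite /= eqxx; case: (wt f) (wt f') (wt g) => [] [] []; rewrite /= ?andbF //.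
  case: (eqVneq (src f) (src f')) => [->|ne]; rewrite /= ?andbF //.
    by rewrite andbC; case: (_ == _) (_ == _) => [] [].
  case: (eqVneq (src f) (tgt g)) => //= e; rewrite -e eq_sym (negbTE ne).
  by [].
- elim/uclsP=> f; elim/uclsP=> g; elim/uclsP=> g'; rewrite !uE.
  apply: ax_ucls; [exact: AxCompDr | | by []].
  rewrite /= eqxx; case: (wt f) (wt g) (wt g') => [] [] []; rewrite /= ?andbF //.
  case: (eqVneq (tgt g) (tgt g')) => [->|ne]; rewrite /= ?andbF //.
    by case: (_ == _) (_ == _) => [] [].
  case: (eqVneq (src f) (tgt g)) => //= e; rewrite e (negbTE ne).
  by [].
- move=> z; elim/uclsP=> f; elim/uclsP=> g; rewrite !uE.
  by apply: ax_ucls; [exact: AxCompZl | | ].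
- move=> z; elim/uclsP=> f; elim/uclsP=> g; rewrite !uE.
  by apply: ax_ucls; [exact: AxCompZr | | ].
- elim/uclsP=> f; elim/uclsP=> f'; elim/uclsP=> g; rewrite !uE.
  apply: ax_ucls; [exact: AxTensDl | | by []].
  by rewrite /= !eqseq_catr; case: (wt f) (wt f') (wt g) => [] [] [];
    rewrite /= ?andbF ?andbT.
- elim/uclsP=> f; elim/uclsP=> g; elim/uclsP=> g'; rewrite !uE.
  apply: ax_ucls; [exact: AxTensDr | | by []].
  by rewrite /= !eqseq_cat // !eqxx; case: (wt f) (wt g) (wt g') => [] [] [];
    rewrite /= ?andbF ?andbT.
- move=> z; elim/uclsP=> f; elim/uclsP=> g; rewrite !uE.
  by apply: ax_ucls; [exact: AxTensZl | | ].
- move=> z; elim/uclsP=> f; elim/uclsP=> g; rewrite !uE.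
  by apply: ax_ucls; [exact: AxTensZr | | ].
Defined.
End Untyped.

(** * (W2) in the diagram algebra *)

Section Transfer.
Variables (k : fieldType) (S : signature) (rel : term k S -> term k S -> Prop).
Local Notation T := (term k S).
Variables (a b : seq (gob S)).
Implicit Types (t u : T).

(** The class of a term in the hom from a to b, or 0 if it is not of that type.
It serves to reindex iterated sums of terms, which is legitimate in the
module [phom rel a b]. *)
Definition proj t : phom rel a b :=
  if @idP (typed a b t) is ReflectT h then cls rel h else 0.

Lemma projE t (h : typed a b t) : proj t = cls rel h.
Proof.
rewrite /proj; case: {-}_ / idP => [h'|//]; apply/cls_eq/EqvRefl.
by case/and3P: h.
Qed.

Lemma proj_ucls t u : typed a b t -> typed a b u -> proj t = proj u ->
  ucls rel t = ucls rel u.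
Proof. by move=> ht hu; rewrite (projE ht) (projE hu) => /cls_eq/eqv_ucls. Qed.

Lemma proj_add t u : typed a b t -> typed a b u ->
  proj (Add t u) = proj t + proj u.
Proof.
move=> ht hu; rewrite (projE ht) (projE hu) (projE (add_typed ht hu)).
by rewrite -phom_addE.
Qed.

Lemma proj_big (I : Type) (r : seq I) (P : pred I) (F : I -> T) :
  (forall i, P i -> typed a b (F i)) ->
  typed a b (\big[@Add k S/Zero a b]_(i <- r | P i) F i) /\
  proj (\big[@Add k S/Zero a b]_(i <- r | P i) F i) = \sum_(i <- r | P i) proj (F i).
Proof.
move=> tF; elim: r => [|i r [t1 IH]].
  by rewrite !big_nil (projE (zero_typed _ _ _)) zero_typed.
rewrite !big_cons; case: ifP => // Pi; split; first exact: add_typed (tF _ Pi) t1.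
by rewrite proj_add ?tF // IH.
Qed.

(** The term corresponding to [usum]. *)
Fixpoint tsum t n (F : nat -> T) : T :=
  if n is n'.+1 then Add (tsum t n' F) (F n') else t.

Lemma ucls_tsum t n F :
  ucls rel (tsum t n F) =
  usum (ucls rel t : untyped rel) n (fun i => ucls rel (F i)).
Proof. by elim: n => //= n <-; rewrite /dadd /= uaddE. Qed.

Lemma proj_tsum t n F : typed a b t -> (forall i, (i < n)%N -> typed a b (F i)) ->
  typed a b (tsum t n F) /\ proj (tsum t n F) = proj t + \sum_(i < n) proj (F i).
Proof.
move=> ht; elim: n => [|n IH] hF; first by rewrite big_ord0 addr0.
have [i hi|t1 e] := IH; first by apply: hF; exact: ltnW.
by rewrite /= add_typed ?proj_add ?hF //= e big_ord_recr addrA.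
Qed.

Lemma ucls_big (I : Type) (r : seq I) (P : pred I) (F : I -> T) t n G :
  (forall i, P i -> typed a b (F i)) ->
  typed a b t -> (forall i, (i < n)%N -> typed a b (G i)) ->
  \sum_(i <- r | P i) proj (F i) = proj t + \sum_(i < n) proj (G i) ->
  ucls rel (\big[@Add k S/Zero a b]_(i <- r | P i) F i) =
  usum (ucls rel t : untyped rel) n (fun i => ucls rel (G i)).
Proof.
move=> hF ht hG; rewrite -ucls_tsum.
have [t1 <-] := proj_big r hF; have [t2 <-] := proj_tsum ht hG.
exact: proj_ucls.
Qed.

End Transfer.

Section Reindex.
Variables (V : nmodType) (g : nat -> nat -> V) (A C e : nat).

(** In the index set of (W2) one of the two indices determines the other. *)
Lemma sum_diagl d : A = (C + e)%N ->
  \sum_(p : 'I_A.+1 * 'I_C.+1 | (p.2 + (d + e) == p.1 + d)%N) g p.1 p.2 =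
  g e 0 + \sum_(t < C) g (t.+1 + e)%N t.+1.
Proof.
move=> hA; transitivity (\sum_(t < C.+1) g (t + e)%N t); last by rewrite big_ord_recl.
rewrite -(pair_big_dep xpredT (fun (s : 'I_A.+1) (t : 'I_C.+1) => (t + (d + e) == s + d)%N)
  (fun s t => g s t)) (exchange_big_dep xpredT) //=.
apply: eq_bigr => t _.
have lt : (t + e < A.+1)%N by case: t => t /= ht; lia.
rewrite (big_pred1 (Ordinal lt)) // => s.
by rewrite /= -val_eqE /=; apply/eqP/eqP; lia.
Qed.

Lemma sum_diagr a : C = (A + e)%N ->
  \sum_(p : 'I_A.+1 * 'I_C.+1 | (p.2 + a == p.1 + (a + e))%N) g p.1 p.2 =
  g 0 e + \sum_(s < A) g s.+1 (s.+1 + e)%N.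
Proof.
move=> hA; transitivity (\sum_(s < A.+1) g s (s + e)%N); last by rewrite big_ord_recl.
rewrite -(pair_big_dep xpredT (fun (s : 'I_A.+1) (t : 'I_C.+1) => (t + a == s + (a + e))%N)
  (fun s t => g s t)) /=.
apply: eq_bigr => s _.
have lt : (s + e < C.+1)%N by case: s => s /= ht; lia.
rewrite (big_pred1 (Ordinal lt)) // => t.
by rewrite /= -val_eqE /=; apply/eqP/eqP; lia.
Qed.
End Reindex.

(** * The web algebra of a presented web category *)

Section WebInstance.
Variables (k : fieldType) (q : k) (D : Type) (dthk : D -> posn).
Variable rel : term k (web_sig dthk) -> term k (web_sig dthk) -> Prop.
Hypothesis rel_common : forall t u, web_rel_common q t u -> rel t u.
Hypothesis qint_neq0 : forall n, qint q n.+1 != 0.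

Local Notation U := (untyped rel).
Local Notation "[ t ]u" := (ucls rel t : U).
Local Notation m := (fun a b => [Defs.merge k dthk a b]u).
Local Notation s := (fun a b => [Defs.split k dthk a b]u).
Local Notation c := (fun a b => [cross k dthk a b]u).
Local Notation th := (thk : nat -> seq posn).
Local Notation th' := (thk : nat -> dob U).

Lemma common_ucls t u : web_rel_common q t u -> [t]u = [u]u.
Proof.
move=> h; apply/eqv_ucls; apply: typed_rel_eqv (web_rel_common_typed h).
exact: rel_common.
Qed.

Lemma qfact_neq0 n : qfact q n != 0.
Proof. by apply/prodf_neq0 => i _; exact: qint_neq0. Qed.

Lemma qbin_neq0 a b : qbin q (a + b) a != 0.
Proof.
rewrite mulf_neq0 ?invr_eq0 ?qfact_neq0 //; apply/prodf_neq0 => i _.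
have -> : (a + b - i = (a + b - i).-1.+1)%N by case: i => i /= hi; lia.
exact: qint_neq0.
Qed.

Lemma ucls_comp t u : [Comp t u]u = [t]u • [u]u.
Proof. by rewrite /dcomp /= uE. Qed.
Lemma ucls_tens t u : [Tens t u]u = [t]u ⊠ [u]u.
Proof. by rewrite /dtens /= uE. Qed.

Lemma square_switch_typed a b c' d s' t : (s' <= a)%N -> (s' <= b)%N ->
  (t <= c')%N -> (t <= d)%N -> (t + a = s' + d)%N -> (a + c' = b + d)%N ->
  typed (S := web_sig dthk) (th a ++ th c') (th b ++ th d)
    (square_switch k dthk a b c' d s' t).
Proof.
move=> sa sb tc td hst e; apply: comp_typed (comp_typed _ _) _.
+ have -> : th b = th (s' + (b - s'))%N by rewrite subnKC.
  have -> : th d = th ((a - s') + t)%N by congr thk; lia.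
  exact: tens_typed (merge_typed _ _ _ _) (merge_typed _ _ _ _).
+ have -> : (b - s' = c' - t)%N by lia.
  rewrite (catA _ (thk _)) -(catA (thk s')).
  exact: tens_typed (tens_typed (idt_typed _ _ _) (cross_typed _ _ _ _)) (idt_typed _ _ _).
+ have {1}-> : th a = th (s' + (a - s'))%N by rewrite subnKC.
  have {1}-> : th c' = th ((c' - t) + t)%N by rewrite subnK.
  rewrite -!catA (catA (thk s')).
  exact: tens_typed (split_typed _ _ _ _) (split_typed _ _ _ _).
Qed.

Lemma square_switchE a b c' d s' t : (b - s' = c' - t)%N ->
  [square_switch k dthk a b c' d s' t]u = sqr th' m s c s' t (a - s') (c' - t).
Proof.
by move=> e; rewrite /square_switch e !ucls_comp !ucls_tens dcompA dtensA.
Qed.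

Lemma ty_ucls t a b : typed a b t -> dty ([t]u) a b.
Proof. by move=> h; apply/utyE. Qed.

(** The two forms of (W2), for strands of positive thickness. *)
Lemma switchl e c' d : (0 < c')%N -> (0 < d)%N ->
  s (c' + e)%N d • m (d + e)%N c' =
  usum (sqr th' m s c e 0 d c') (minn d c') (fun t =>
    q ^+ ((t.+1 + e) * t.+1) ⋅
    sqr th' m s c (t.+1 + e) t.+1 (d - t.+1) (c' - t.+1)).
Proof.
rewrite (minnC d); move=> hc hd; pose F s' t := Scale (q ^+ (s' * t))
  (square_switch k dthk (d + e) (c' + e) c' d s' t).
have tF s' t : (t <= minn c' d)%N -> s' = (t + e)%N ->
    typed (S := web_sig dthk) (th (d + e)%N ++ th c') (th (c' + e)%N ++ th d) (F s' t).
  move=> ht hs; apply: scale_typed; apply: square_switch_typed; lia.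
rewrite -ucls_comp (common_ucls (RSwitch q dthk _ _ hc hd _)); [|lia|lia|lia].
rewrite (@ucls_big _ _ _ _ _ _ _ _ _ (F e 0%N) (minn c' d) (fun t => F (t.+1 + e)%N t.+1)).
- have FE s' t : (t <= minn c' d)%N -> s' = (t + e)%N ->
      [F s' t]u = q ^+ (s' * t) ⋅ sqr th' m s c s' t (d - t) (c' - t).
    move=> ht hs; rewrite /F -uscaleE square_switchE; last by lia.
    by congr (_ ⋅ sqr _ _ _ _ _ _ _ _); lia.
  rewrite FE // muln0 expr0 dscale1 !subn0; apply: eq_usum => t ht.
  by rewrite FE.
- move=> [[s' hs] [t ht]] /= /eqP h; apply: tF; lia.
- exact: tF.
- by move=> t ht; apply: tF.
rewrite (sum_diagl (fun s' t => @proj _ _ rel _ _ (F s' t))) //; lia.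
Qed.

Lemma switchr e a b : (0 < a)%N -> (0 < b)%N ->
  s b (a + e)%N • m a (b + e)%N =
  usum (sqr th' m s c 0 e a b) (minn a b) (fun s' =>
    q ^+ (s'.+1 * (s'.+1 + e)) ⋅
    sqr th' m s c s'.+1 (s'.+1 + e) (a - s'.+1) (b - s'.+1)).
Proof.
move=> ha hb; pose F s' t := Scale (q ^+ (s' * t))
  (square_switch k dthk a b (b + e) (a + e) s' t).
have tF s' t : (s' <= minn a b)%N -> t = (s' + e)%N ->
    typed (S := web_sig dthk) (th a ++ th (b + e)%N) (th b ++ th (a + e)%N) (F s' t).
  move=> ht hs; apply: scale_typed; apply: square_switch_typed; lia.
rewrite -ucls_comp (common_ucls (RSwitch q dthk ha hb _ _ _)); [|lia|lia|lia].
rewrite (@ucls_big _ _ _ _ _ _ _ _ _ (F 0%N e) (minn a b) (fun s' => F s'.+1 (s'.+1 + e)%N)).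
- have FE s' t : (s' <= minn a b)%N -> t = (s' + e)%N ->
      [F s' t]u = q ^+ (s' * t) ⋅ sqr th' m s c s' t (a - s') (b - s').
    move=> ht hs; rewrite /F -uscaleE square_switchE; last by lia.
    by congr (_ ⋅ sqr _ _ _ _ _ _ _ _); lia.
  rewrite FE // mul0n expr0 dscale1 !subn0; apply: eq_usum => t ht.
  by rewrite FE.
- move=> [[s' hs] [t ht]] /= /eqP h; apply: tF; lia.
- exact: tF.
- by move=> t ht; apply: tF.
rewrite (sum_diagr (fun s' t => @proj _ _ rel _ _ (F s' t))) //; lia.
Qed.

Local Notation I a := (did (th' a) : U).

Lemma ucls_merges0 a : m a 0 = I a. Proof. by case: a => //= a; rewrite /Defs.merge addn0. Qed.
Lemma ucls_splits0 a : s a 0 = I a. Proof. by case: a => //= a; rewrite /Defs.split addn0. Qed.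
Lemma ucls_crosss0 a : c a 0 = I a. Proof. by case: a => //= a; rewrite /cross addn0. Qed.

Lemma ty_um a b : dty (m a b) (dcat (th' a) (th' b)) (th' (a + b)%N).
Proof. exact/ty_ucls/merge_typed. Qed.
Lemma ty_us a b : dty (s a b) (th' (a + b)%N) (dcat (th' a) (th' b)).
Proof. exact/ty_ucls/split_typed. Qed.

Lemma umergeA a b c' : m (a + b)%N c' • (m a b ⊠ I c') = m a (b + c')%N • (I a ⊠ m b c').
Proof.
have tm := ty_um.
case: a => [|a]; first by rewrite dtens_id (dcompm1 (tm b c')) dtens1m (dcomp1m (tm b c')).
case: b => [|b]; first by rewrite !addn0 ucls_merges0 !add0n.
case: c' => [|c'].
  by rewrite addn0 !ucls_merges0 dtensm1 dtens_id (dcompm1 (tm _ _)) (dcomp1m (tm _ _)).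
by rewrite -!ucls_tens -!ucls_comp; apply/common_ucls/RMergeA.
Qed.

Lemma usplitA a b c' : (s a b ⊠ I c') • s (a + b)%N c' = (I a ⊠ s b c') • s a (b + c')%N.
Proof.
have ts := ty_us.
case: a => [|a]; first by rewrite dtens_id (dcomp1m (ts b c')) dtens1m (dcompm1 (ts b c')).
case: b => [|b]; first by rewrite !addn0 ucls_splits0 !add0n.
case: c' => [|c'].
  by rewrite addn0 !ucls_splits0 dtensm1 dtens_id (dcompm1 (ts _ _)) (dcomp1m (ts _ _)).
by rewrite -!ucls_tens -!ucls_comp; apply/common_ucls/RSplitA.
Qed.

Lemma ububble a b : m a b • s a b = qbin q (a + b) a ⋅ I (a + b)%N.
Proof.
case: a => [|a].
  rewrite /qbin /qfact !big_ord0 divr1 dscale1; exact: dcomp1m (ty_id _).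
case: b => [|b].
  rewrite ucls_merges0 ?ucls_splits0 (dcomp1m (ty_id _)) addn0.
  rewrite /qbin; have -> : \prod_(i < a.+1) qint q (a.+1 - i) = qfact q a.+1.
    rewrite /qfact (reindex_inj rev_ord_inj); apply: eq_bigr => i _ /=.
    by congr (qint q _); have := ltn_ord i; lia.
  by rewrite divff ?dscale1 // qfact_neq0.
by rewrite -ucls_comp (common_ucls (RBubble _ _ _ _)) // -uscaleE.
Qed.

Let cat0 a : dcat (th' a) (th' 0) = th' a. Proof. exact: dcats0. Qed.

(** With a strand of thickness 0, (W2) is trivial. *)
Lemma uswitchl e c' d : s (c' + e)%N d • m (d + e)%N c' =
  usum (sqr th' m s c e 0 d c') (minn d c') (fun t =>
    q ^+ ((t.+1 + e) * t.+1) ⋅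
    sqr th' m s c (t.+1 + e) t.+1 (d - t.+1) (c' - t.+1)).
Proof.
case: d => [|d].
  rewrite min0n -[RHS]/(sqr th' m s c e 0 0 c') /sqr
    (ucls_splits0 e) (ucls_splits0 c') (ucls_splits0 (c' + e)).
  rewrite !dtens_id dtensm1 !add0n cat0 (dcomp1m (ty_id _)).
  have t1 := ty_um e c'; rewrite (dcompm1 t1) addnC; exact: dcomp1m t1.
case: c' => [|c']; last exact: switchl.
rewrite minn0 -[RHS]/(sqr th' m s c e 0 d.+1 0) /sqr
  (ucls_merges0 e) (ucls_merges0 d.+1) (ucls_merges0 (d.+1 + e)).
rewrite ?(ucls_crosss0 d.+1) !dtens_id dtensm1 cat0.
have t1 := ty_us e d.+1; rewrite !(dcomp1m t1) [(d.+1 + e)%N]addnC; exact: dcompm1 t1.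
Qed.

Lemma uswitchr e a b : s b (a + e)%N • m a (b + e)%N =
  usum (sqr th' m s c 0 e a b) (minn a b) (fun s' =>
    q ^+ (s'.+1 * (s'.+1 + e)) ⋅
    sqr th' m s c s'.+1 (s'.+1 + e) (a - s'.+1) (b - s'.+1)).
Proof.
case: a => [|a].
  rewrite min0n -[RHS]/(sqr th' m s c 0 e 0 b) /sqr !dtens_id dtens1m add0n.
  have t1 := ty_us b e; rewrite !(dcomp1m t1); exact: dcompm1 t1.
case: b => [|b]; last exact: switchr.
rewrite minn0 -[RHS]/(sqr th' m s c 0 e a.+1 0) /sqr ?(ucls_crosss0 a.+1) !dtens_id (dcomp1m (ty_id _)).
have t1 := ty_um a.+1 e; rewrite dtens1m (dcompm1 t1); exact: dcomp1m t1.
Qed.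

(** The common relations of the two web categories, as a web algebra. *)
Definition web_alg : webalg q :=
  @WebAlg k q U th' m s c (fun a b => qbin q (a + b) a) erefl ty_um ty_us
  (fun a b => ty_ucls (cross_typed k dthk a b))
  (fun _ => erefl) ucls_merges0 (fun _ => erefl) ucls_splits0 (fun _ => erefl)
  ucls_crosss0 umergeA usplitA uswitchl uswitchr ububble qbin_neq0.
End WebInstance.

(** * Functors defined on generators *)

Section Subst.
Variables (k : fieldType) (O : eqType) (M M' : Type).
Variables (sM tM : M -> seq O) (sM' tM' : M' -> seq O).
Local Notation S := (@Signature O M sM tM).
Local Notation S' := (@Signature O M' sM' tM').
Variable phi : M -> term k S'.

(** Replaces each generator x by phi x. *)
Fixpoint subst (t : term k S) : term k S' :=
  match t with
  | Gen x => phi x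
  | Id a => @Id k S' a
  | Comp f g => Comp (subst f) (subst g)
  | Tens f g => Tens (subst f) (subst g)
  | Zero a b => @Zero k S' a b
  | Add f g => Add (subst f) (subst g)
  | Scale z f => Scale z (subst f)
  end.

Hypothesis phi_typed : forall x, typed (S := S') (sM x) (tM x) (phi x).

Lemma src_subst t : src (subst t) = src t.
Proof.
by elim: t => //= [x|f -> g ->] //; case/and3P: (phi_typed x) => _ /eqP.
Qed.

Lemma tgt_subst t : tgt (subst t) = tgt t.
Proof.
by elim: t => //= [x|f -> g ->] //; case/and3P: (phi_typed x) => _ _ /eqP.
Qed.

Lemma wt_subst t : wt (subst t) = wt t.
Proof.
elim: t => //= [x|f -> g ->|f -> g ->|f -> g ->]; rewrite ?src_subst ?tgt_subst //.
by case/and3P: (phi_typed x).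
Qed.

Lemma subst_typed a b t : typed (S := S) a b t -> typed (S := S') a b (subst t).
Proof. by rewrite /typed wt_subst src_subst tgt_subst. Qed.

Lemma subst_axiom t u : smc_axiom t u -> smc_axiom (subst t) (subst u).
Proof.
by case=> *; rewrite /= -?src_subst -?tgt_subst; constructor.
Qed.

Variables (rel : term k S -> term k S -> Prop).
Variables (rel' : term k S' -> term k S' -> Prop).
Hypothesis subst_rel : forall t u, rel t u -> wt t -> wt u -> parallel t u ->
  eqv rel' (subst t) (subst u).

Lemma subst_eqv t u : eqv rel t u -> eqv rel' (subst t) (subst u).
Proof.
elim=> {t u} /=.
- move=> t u ax wt wu [e1 e2]; apply: EqvAx; rewrite ?wt_subst //.
    exact: subst_axiom.
  by rewrite /parallel !src_subst !tgt_subst.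
- by move=> *; exact: subst_rel.
- by move=> t wt; apply: EqvRefl; rewrite wt_subst.
- by move=> t u _; exact: EqvSym.
- by move=> t u v _ h1 _; exact: EqvTrans.
- by move=> f f' g g' e _ h1 _ h2; apply: EqvComp; rewrite ?src_subst ?tgt_subst.
- by move=> f f' g g' _ h1 _ h2; exact: EqvTens.
- move=> f f' g g' [e1 e2] _ h1 _ h2; apply: EqvAdd => //.
  by rewrite /parallel !src_subst !tgt_subst.
- by move=> z f f' _; exact: EqvScale.
Qed.

(** The action on homs of the functor defined by a substitution; this functor is
the identity on objects. *)
Definition subst_map (a b : seq O) (x : phom rel a b) : phom rel' a b :=
  cls rel' (subst_typed (rep_typed x)).

Lemma subst_mapE (a b : seq O) t (ht : typed (S := S) a b t) :
  subst_map (cls rel ht) = cls rel' (subst_typed ht).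
Proof. by apply/cls_eq/subst_eqv/rep_cls. Qed.

Definition subst_functor : smfunctor (presented rel) (presented rel').
Proof.
refine (@SMFunctor k (presented rel) (presented rel') id subst_map
  _ _ _ erefl (fun _ _ => erefl) _).
- move=> a b z; elim/clsP=> f hf; elim/clsP=> g hg.
  suff: subst_map (phom_add (phom_scale z (cls rel hf)) (cls rel hg)) =
        phom_add (phom_scale z (subst_map (cls rel hf))) (subst_map (cls rel hg)).
    by [].
  rewrite phom_scaleE phom_addE !subst_mapE phom_scaleE phom_addE.
  apply/cls_eq/EqvRefl.
  by case/and3P: (subst_typed (add_typed (scale_typed z hf) hg)).
- move=> a; rewrite /idm /= /pid subst_mapE; apply/cls_eq; exact: EqvRefl.
- move=> a b c; elim/clsP=> f hf; elim/clsP=> g hg; rewrite /comp /=.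
  rewrite pcompE !subst_mapE pcompE; apply/cls_eq/EqvRefl.
  by case/and3P: (subst_typed (comp_typed hf hg)).
- move=> a b c d; elim/clsP=> f hf; elim/clsP=> g hg; rewrite /tens /=.
  rewrite ptensE !subst_mapE ptensE; have hfg := subst_typed (tens_typed hf hg).
  have e : eqv rel' (subst (Tens f g)) (Tens (subst f) (subst g)).
    by apply: EqvRefl; case/and3P: hfg.
  exact: heq_cls e.
Defined.

Lemma subst_functor_mor t (ht : wt t) u (hu : wt u) :
  eqv rel' (subst t) u ->
  heq (fmap subst_functor (mor rel t ht)) (mor rel' u hu).
Proof. move=> h; rewrite /fmap /= /mor subst_mapE; exact: (heq_cls _ _ h). Qed.

End Subst.

(** Two substitutions which are mutually inverse on generators are so on all
terms. *)
Lemma subst_substE (k : fieldType) (O : eqType) (M M' : Type)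
    (sM tM : M -> seq O) (sM' tM' : M' -> seq O)
    (phi : M -> term k (Signature sM' tM')) (psi : M' -> term k (Signature sM tM))
    (rel : term k (Signature sM tM) -> term k (Signature sM tM) -> Prop) :
  (forall x, typed (S := Signature sM' tM') (sM x) (tM x) (phi x)) ->
  (forall x, typed (S := Signature sM tM) (sM' x) (tM' x) (psi x)) ->
  (forall x, eqv rel (subst psi (phi x)) (@Gen k (Signature sM tM) x)) ->
  forall t, wt t -> eqv rel (subst psi (subst phi t)) t.
Proof.
move=> hphi hpsi h; elim=> //=.
- by move=> a _; exact: EqvRefl.
- move=> f IHf g IHg /and3P[wf wg /eqP e]; apply: EqvComp; [|exact: IHf|exact: IHg].
  by rewrite !(src_subst, tgt_subst).
- by move=> f IHf g IHg /andP[wf wg]; apply: EqvTens; [exact: IHf|exact: IHg].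
- by move=> a b _; exact: EqvRefl.
- move=> f IHf g IHg /and4P[wf wg /eqP e1 /eqP e2].
  apply: EqvAdd; [|exact: IHf|exact: IHg].
  by split; rewrite !(src_subst, tgt_subst).
- by move=> z f IHf wf; exact/EqvScale/IHf.
Qed.

Section CommonSubst.
Variables (k : fieldType) (q : k) (D D' : Type) (dthk : D -> posn) (dthk' : D' -> posn).
Variables (dt dti : D -> term k (web_sig dthk')).

(** Substitution of the dots alone: merges, splits and crossings are kept. *)
Definition web_subst (x : webgen D) : term k (web_sig dthk') :=
  match x with
  | WM a b => gen k dthk' (WM a b)
  | WS a b => gen k dthk' (WS a b)
  | WC a b => gen k dthk' (WC a b)
  | WCi a b => gen k dthk' (WCi a b)
  | WD i => dt i
  | WDi i => dti i
  end.
Local Notation sb := (@subst k _ _ _ (web_src dthk) (web_tgt dthk)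
  (web_src dthk') (web_tgt dthk') web_subst).

Lemma subst_merge a b : sb (Defs.merge k dthk a b) = Defs.merge k dthk' a b.
Proof. by case: a b => [|a] [|b]. Qed.
Lemma subst_split a b : sb (Defs.split k dthk a b) = Defs.split k dthk' a b.
Proof. by case: a b => [|a] [|b]. Qed.
Lemma subst_cross a b : sb (cross k dthk a b) = cross k dthk' a b.
Proof. by case: a b => [|a] [|b]. Qed.
Lemma subst_crossV a b : sb (crossV k dthk a b) = crossV k dthk' a b.
Proof. by case: a b => [|a] [|b]. Qed.

Lemma subst_mts t n : sb (mts t n) = mts (sb t) n.
Proof.
rewrite /mts /=; congr (Comp (Comp _ _) _).
- by elim: (nseq n 1) => //= a r ->; rewrite subst_merge.
- by elim: n => //= n ->.
- by elim: (nseq n 1) => //= a r ->; rewrite subst_split.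
Qed.

Lemma subst_term z a b c d s t :
  sb (Scale z (square_switch k dthk a b c d s t)) =
  Scale z (square_switch k dthk' a b c d s t).
Proof. by rewrite /= !(subst_merge, subst_split, subst_cross). Qed.

Lemma subst_big (I : Type) (r : seq I) (P : pred I) F a b :
  sb (\big[@Add k (web_sig dthk)/Zero a b]_(i <- r | P i) F i) =
  \big[@Add k (web_sig dthk')/@Zero k (web_sig dthk') a b]_(i <- r | P i) sb (F i).
Proof.
elim: r => [|i r IH]; first by rewrite !big_nil.
by rewrite !big_cons; case: ifP => //= _; rewrite IH.
Qed.

Variable rel : term k (web_sig dthk') -> term k (web_sig dthk') -> Prop.
Hypothesis rel_common : forall t u, web_rel_common q t u -> rel t u.

Lemma common_eqv t u : web_rel_common q t u -> eqv rel t u.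
Proof.
by move=> h; apply: typed_rel_eqv (web_rel_common_typed h); exact: rel_common.
Qed.

Hypothesis dt_inv : forall i, 
  eqv rel (Comp (dti i) (dt i)) (idt k dthk' (val (dthk i))) /\
  eqv rel (Comp (dt i) (dti i)) (idt k dthk' (val (dthk i))).

Lemma subst_common t u : web_rel_common q t u -> eqv rel (sb t) (sb u).
Proof.
case=> *; rewrite /= ?(subst_merge, subst_split, subst_cross, subst_crossV).
- by apply/common_eqv/RMergeA.
- by apply/common_eqv/RSplitA.
- rewrite subst_big; apply: common_eqv.
  under eq_bigr do rewrite subst_term.
  exact: RSwitch.
- by apply/common_eqv/RBubble.
- by apply/common_eqv/RCrossV.
- by apply/common_eqv/RVCross.
- exact: (proj1 (dt_inv _)).
- exact: (proj2 (dt_inv _)).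
Qed.

End CommonSubst.

(** * The isomorphism *)

Section Iso.
Variables (k : fieldType) (q : k).
Hypothesis qint_neq0 : forall n, qint q n.+1 != 0.
Local Notation rel := (@web_rel k q).
Local Notation rel' := (@web_rel' k q).
Local Notation W := (web_alg (@RCommon' k q) qint_neq0).
Local Notation "[ t ]u" := (ucls rel' t : W).
Local Notation I a := (did (wthk a) : W).
Local Notation m := (@wm _ _ W).
Local Notation s := (@ws _ _ W).
Local Notation c := (@wc _ _ W).
Local Notation y := ([dot1' k]u).
Local Notation z := ([dot1V' k]u).
Local Notation cV a b := ([crossV k dthk' a b]u).

Lemma qint1 : qint q 1 = 1.
Proof.
have := qint_neq0 0; rewrite /qint expr1 => h; rewrite divff //.
by apply: contraNneq h => ->; rewrite mul0r.
Qed.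

Lemma wbin1 n : wbin W 1 n = qint q n.+1.
Proof.
by rewrite /= /qbin /qfact !big_ord_recl !big_ord0 !mulr1 subn0 qint1 divr1 add1n.
Qed.

Lemma rel_ucls t u : rel' t u -> [t]u = [u]u.
Proof. by move=> h; apply: eqv_ucls; exact: typed_rel_eqv h (web_rel_typed' h). Qed.

Lemma ty_y : dty y (wthk 1) (wthk 1). Proof. exact/ty_ucls/dot1_typed'. Qed.
Lemma ty_z : dty z (wthk 1) (wthk 1). Proof. exact/ty_ucls/dot1V_typed'. Qed.
Lemma ty_cV a b : dty (cV a b) (dcat (wthk b) (wthk a)) (dcat (wthk a : dob W) (wthk b)).
Proof. exact/ty_ucls/crossV_typed. Qed.

Lemma wcompE t u : [Comp t u]u = [t]u • [u]u. Proof. exact: ucls_comp. Qed.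
Lemma wtensE t u : [Tens t u]u = [t]u ⊠ [u]u. Proof. exact: ucls_tens. Qed.
Lemma wscaleE e t : [Scale e t]u = e ⋅ [t]u. Proof. by rewrite /dscale /= uE. Qed.
Lemma wcrossE a b : [cross k dthk' a b]u = c a b. Proof. by []. Qed.
Lemma widtE a : [idt k dthk' a]u = I a. Proof. by []. Qed.

Lemma cV_c a b : (0 < a)%N -> (0 < b)%N -> cV a b • c a b = I a ⊠ I b.
Proof.
move=> ha hb; rewrite -wcrossE -!widtE -wcompE -wtensE.
exact/rel_ucls/RCommon'/RCrossV.
Qed.

Lemma c_cV a b : (0 < a)%N -> (0 < b)%N -> c a b • cV a b = I b ⊠ I a.
Proof.
move=> ha hb; rewrite -wcrossE -!widtE -wcompE -wtensE.
exact/rel_ucls/RCommon'/RVCross.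
Qed.

Lemma zy : z • y = I 1.
Proof. rewrite -widtE -wcompE; exact: (rel_ucls (RCommon' (RDotV q dthk' tt))). Qed.
Lemma yz : y • z = I 1.
Proof. rewrite -widtE -wcompE; exact: (rel_ucls (RCommon' (RVDot q dthk' tt))). Qed.

Lemma cy : c 1 1 • (y ⊠ I 1) = (I 1 ⊠ y) • cV 1 1.
Proof. rewrite -wcrossE -!widtE -!wtensE -!wcompE; exact: rel_ucls (RDotCrossL' _). Qed.
Lemma yc : (y ⊠ I 1) • c 1 1 = cV 1 1 • (I 1 ⊠ y).
Proof. rewrite -wcrossE -!widtE -!wtensE -!wcompE; exact: rel_ucls (RDotCrossR' _). Qed.

(** Relation (W4) for thickness 1, free of inverse crossings. *)
Lemma cyc : c 1 1 • (y ⊠ I 1) • c 1 1 = I 1 ⊠ y.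
Proof.
have ty := ty_y.
by rewrite -dcompA cy dcompA cV_c // dtens_id compm1 //; tys.
Qed.

Lemma yyc : (y ⊠ y) • c 1 1 = c 1 1 • (y ⊠ y).
Proof.
have ty := ty_y.
have e1 : y ⊠ y = (I 1 ⊠ y) • (y ⊠ I 1).
  by rewrite interl ?comp1m ?compm1 //; tys.
have e2 : y ⊠ y = (y ⊠ I 1) • (I 1 ⊠ y).
  by rewrite interl ?comp1m ?compm1 //; tys.
by rewrite {1}e1 dcompA yc -dcompA -cy dcompA -e2.
Qed.

Lemma zzc : (z ⊠ z) • c 1 1 = c 1 1 • (z ⊠ z).
Proof.
have ty := ty_y; have tz := ty_z.
have e1 : (z ⊠ z) • (y ⊠ y) = did (dcat (wthk 1) (wthk 1)).
  by rewrite interl ?zy ?dtens_id //; tys.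
have e2 : (y ⊠ y) • (z ⊠ z) = did (dcat (wthk 1) (wthk 1)).
  by rewrite interl ?yz ?dtens_id //; tys.
transitivity ((z ⊠ z) • ((y ⊠ y) • c 1 1) • (z ⊠ z)).
  by rewrite yyc dcompA e2 compm1 //; tys.
by rewrite -!dcompA e1 comp1m //; tys.
Qed.

(** The composite for n + 1 strands, with its first strand apart. *)
Lemma mtsS (t : term k (web_sig dthk')) n :
  mts t n.+1 =
  Comp (Comp (Comp (Defs.merge k dthk' 1 n)
                   (Tens (idt k dthk' 1) (merges k dthk' (nseq n 1%N))))
             (Tens t (tpow t n)))
       (Comp (Tens (idt k dthk' 1) (splits k dthk' (nseq n 1%N)))
             (Defs.split k dthk' 1 n)).
Proof. by rewrite /mts /= sumn_nseq mul1n. Qed.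

Lemma peel_strand (f M P S : W) n (w : dob W) :
  dty f (wthk 1) (wthk 1) -> dty M w (wthk n) -> dty P w w -> dty S (wthk n) w ->
  (m 1 n • (I 1 ⊠ M)) • (f ⊠ P) • (I 1 ⊠ S) • s 1 n =
  m 1 n • (f ⊠ (M • P • S)) • s 1 n.
Proof.
move=> tf tM tP tS; rewrite !dcompA; congr (_ • _); rewrite -!dcompA.
by rewrite !(@interl _ W) ?comp1m ?compm1 ?dcompA //; tys.
Qed.

(** The composite m_{1^n} t^{⊗n} s_{1^n} is [n]! times the thick dot. *)
Lemma ucls_mts t n : dty ([t]u) (wthk 1) (wthk 1) ->
  [mts t n]u = qfact q n ⋅ dots ([t]u) n.
Proof.
move=> tt; elim: n => [|n IH].
  rewrite /qfact big_ord0 dscale1 /mts !wcompE.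
  rewrite -[LHS]/((I 0 • I 0) • I 0) !(dcomp1m (ty_id _)); by [].
pose w := flatten (map (thk : nat -> dob W) (nseq n 1%N)).
have tM : dty ([merges k dthk' (nseq n 1%N)]u) w (wthk n).
  apply: ty_ucls; have := merges_typed k dthk' (nseq n 1%N).
  by rewrite sumn_nseq mul1n.
have tS : dty ([splits k dthk' (nseq n 1%N)]u) (wthk n) w.
  apply: ty_ucls; have := splits_typed k dthk' (nseq n 1%N).
  by rewrite sumn_nseq mul1n.
have tP : dty ([tpow t n]u) w w.
  rewrite /w; elim: (n) => [|p IHp]; first exact: ty_id.
  rewrite [tpow _ _]/= wtensE; exact: ty_tens tt IHp.
have e := peel_strand tt tM tP tS.
transitivity (m 1 n • ([t]u ⊠ [mts t n]u) • s 1 n).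
  apply: etrans (etrans e _); last by rewrite /mts !wcompE dcompA.
  by rewrite mtsS !wcompE !wtensE !dcompA.
rewrite IH dtensZr dcompZl dcompZr /qfact big_ord_recr /dots -/(dots _) dscaleA.
by rewrite -/(wbin W 1 n) wbin1 mulfK // qint_neq0.
Qed.

Lemma dots_1 t : dty t (wthk 1 : dob W) (wthk 1) -> dots t 1 = t.
Proof.
move=> tt; rewrite /dots wbin1 qint1 invr1 dscale1 wms0 wss0 wthk0 dtensm1.
by rewrite compm1 ?comp1m //; tys.
Qed.

Lemma ucls_xdef n : [xdef' q n]u = dots y n.
Proof.
rewrite wscaleE ucls_mts; last exact: ty_y.
by rewrite dscaleA mulVf ?dscale1 // qfact_neq0.
Qed.

Lemma ucls_xVdef n : [xVdef' q n]u = dots z n.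
Proof.
rewrite wscaleE ucls_mts; last exact: ty_z.
by rewrite dscaleA mulVf ?dscale1 // qfact_neq0.
Qed.

(** The images of the generators of Web' in Web, and conversely. *)
Definition phi := @web_subst k unit posn id
  (fun _ => dot k 1) (fun _ => dotV k 1).
Definition psi := @web_subst k posn unit dthk'
  (fun a => xdef' q (val a)) (fun a => xVdef' q (val a)).
Local Notation sphi := (@subst k _ _ _ (web_src dthk') (web_tgt dthk')
  (web_src id) (web_tgt id) phi).
Local Notation spsi := (@subst k _ _ _ (web_src id) (web_tgt id)
  (web_src dthk') (web_tgt dthk') psi).

Lemma phi_typed x :
  typed (S := web_sig id) (web_src dthk' x) (web_tgt dthk' x) (phi x).
Proof. by case: x => *; rewrite /typed /= !eqxx. Qed.

Lemma psi_typed x :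
  typed (S := web_sig dthk') (web_src id x) (web_tgt id x) (psi x).
Proof.
case: x => [a b|a b|a b|a b|a|a] /=; try by rewrite /typed /= !eqxx.
- by rewrite -thk_val; apply: scale_typed; apply: mts_typed.
- by rewrite -thk_val; apply: scale_typed; apply: mts_typed.
Qed.

Lemma rel_eqv t u : rel t u -> eqv rel t u.
Proof. by move=> h; exact: typed_rel_eqv h (web_rel_typed h). Qed.

Lemma phi_rel t u : rel' t u -> eqv rel (sphi t) (sphi u).
Proof.
case=> [{}t {}u h||]; last 2 first.
- by apply: rel_eqv; exact: (@RDotCrossL k q 1 1).
- by apply: rel_eqv; exact: (@RDotCrossR k q 1 1).
apply: subst_common h; first exact: RCommon.
by move=> i; split; apply: common_eqv; [exact: RCommon|exact: RDotV|exact: RCommon|exact: RVDot].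
Qed.

Lemma psi_inv (a : posn) :
  eqv rel' (Comp (xVdef' q (val a)) (xdef' q (val a))) (idt k dthk' (val a)) /\
  eqv rel' (Comp (xdef' q (val a)) (xVdef' q (val a))) (idt k dthk' (val a)).
Proof.
have tx := @mts_typed k _ dthk' _ (val a) (dot1_typed' k).
have tV := @mts_typed k _ dthk' _ (val a) (dot1V_typed' k).
have t1 := comp_typed (scale_typed (qfact q (val a))^-1 tV)
  (scale_typed (qfact q (val a))^-1 tx).
have t2 := comp_typed (scale_typed (qfact q (val a))^-1 tx)
  (scale_typed (qfact q (val a))^-1 tV).
split; apply: ucls_eqv; rewrite ?wcompE ?ucls_xdef ?ucls_xVdef ?widtE.
- by case/and3P: t1.
- exact: dots_inv ty_z ty_y zzc yyc zy.
- by case/and3P: t2.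
- exact: dots_inv ty_y ty_z yyc zzc yz.
Qed.

Lemma spsi_dot a : [spsi (dot k a)]u = dots y a.
Proof. by case: a => [|a] //; rewrite -ucls_xdef. Qed.

Lemma spsi_dotV a : [spsi (dotV k a)]u = dots z a.
Proof. by case: a => [|a] //; rewrite -ucls_xVdef. Qed.

Lemma spsi_comp f g : [spsi (Comp f g)]u = [spsi f]u • [spsi g]u.
Proof. exact: wcompE. Qed.
Lemma spsi_tens f g : [spsi (Tens f g)]u = [spsi f]u ⊠ [spsi g]u.
Proof. exact: wtensE. Qed.
Lemma spsi_scale e f : [spsi (Scale e f)]u = e ⋅ [spsi f]u.
Proof. exact: wscaleE. Qed.
Lemma spsi_idt a : [spsi (idt k id a)]u = I a.
Proof. by []. Qed.
Lemma spsi_merge a b : [spsi (Defs.merge k id a b)]u = m a b.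
Proof. by rewrite subst_merge. Qed.
Lemma spsi_split a b : [spsi (Defs.split k id a b)]u = s a b.
Proof. by rewrite subst_split. Qed.
Lemma spsi_cross a b : [spsi (cross k id a b)]u = c a b.
Proof. by rewrite subst_cross. Qed.
Lemma spsi_crossV a b : [spsi (crossV k id a b)]u = cV a b.
Proof. by rewrite subst_crossV. Qed.
Let spsiE := (spsi_comp, spsi_tens, spsi_scale, spsi_dot, spsi_dotV, spsi_idt,
  spsi_merge, spsi_split, spsi_cross, spsi_crossV).

(** The relations of Web hold for the thick dots of Web'. *)
Lemma psi_rel t u : rel t u -> eqv rel' (spsi t) (spsi u).
Proof.
move=> h; have [A [B [/(subst_typed psi_typed) + _]]] := web_rel_typed h.
case/and3P=> wt _ _; apply: ucls_eqv wt _.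
have X a := ty_dots ty_y a; have cX := dots_cross ty_y yyc cyc.
case: h => {t u A B} [t u h|a b ha hb|a b ha hb|a b ha hb|a b ha hb|a ha|a ha].
- by apply: eqv_ucls; apply: subst_common h => [*|a]; [exact: RCommon' | exact: psi_inv].
- have tV := ty_cV b a; have Xa := X a.
  rewrite !spsiE -(cX a b) !dcompA c_cV // dtens_id compm1 //; tys.
- have tV := ty_cV b a; have Xb := X b.
  rewrite !spsiE -(cX b a) -dcompA cV_c // dtens_id comp1m //; tys.
- by rewrite !spsiE (split_dots ty_y yyc).
- by rewrite !spsiE (merge_dots ty_y yyc).
- rewrite subst_mts ucls_mts spsi_dot; last exact: X.
  by rewrite spsi_scale spsi_dot dots_1 //; exact: ty_y.
- rewrite subst_mts ucls_mts spsi_dotV; last exact: ty_dots ty_z 1.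
  by rewrite spsi_scale spsi_dotV dots_1 //; exact: ty_z.
Qed.

Lemma dot_val (a : posn) : dot k (val a) = gen k id (WD a).
Proof. by case: a => [[|a] ha] //=; congr (gen _ _ (WD _)); exact: val_inj. Qed.

Lemma dotV_val (a : posn) : dotV k (val a) = gen k id (WDi a).
Proof. by case: a => [[|a] ha] //=; congr (gen _ _ (WDi _)); exact: val_inj. Qed.

Lemma scale_cancel (S : signature) (r : term k S -> term k S -> Prop) e t u :
  e != 0 -> eqv r t (Scale e u) -> eqv r (Scale e^-1 t) u.
Proof.
move=> e0 h; have [_ /= wu [p1 p2]] := eqv_typed h.
apply: EqvTrans (EqvScale e^-1 h) _.
apply: (@EqvTrans _ _ _ _ (Scale (e^-1 * e) u)).
  by apply: EqvAx => //; exact: AxScaleA.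
by rewrite mulVf //; apply: EqvAx => //; exact: AxScale1.
Qed.

(** By (W6), the dots of Web are given by the same formula. *)
Lemma sphi_xdef (a : posn) : eqv rel (sphi (xdef' q (val a))) (gen k id (WD a)).
Proof.
have -> : sphi (xdef' q (val a)) =
    Scale (qfact q (val a))^-1 (mts (dot k 1) (val a)).
  exact: (congr1 (Scale _) (subst_mts _ _ _ _)).
rewrite -dot_val; apply: scale_cancel; first exact: qfact_neq0.
by apply: rel_eqv; apply: RDotPow; exact: valP a.
Qed.

Lemma sphi_xVdef (a : posn) : eqv rel (sphi (xVdef' q (val a))) (gen k id (WDi a)).
Proof.
have -> : sphi (xVdef' q (val a)) =
    Scale (qfact q (val a))^-1 (mts (dotV k 1) (val a)).
  exact: (congr1 (Scale _) (subst_mts _ _ _ _)).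
rewrite -dotV_val; apply: scale_cancel; first exact: qfact_neq0.
by apply: rel_eqv; apply: RDotVPow; exact: valP a.
Qed.

Lemma spsi_phi x : eqv rel' (spsi (phi x)) (gen k dthk' x).
Proof.
case: x => [a b|a b|a b|a b|[]|[]]; try exact: EqvRefl.
- apply: ucls_eqv; first by rewrite (wt_subst psi_typed).
  by rewrite spsi_dot dots_1 //; exact: ty_y.
- apply: ucls_eqv; first by rewrite (wt_subst psi_typed).
  by rewrite spsi_dotV dots_1 //; exact: ty_z.
Qed.

Lemma sphi_psi x : eqv rel (sphi (psi x)) (gen k id x).
Proof.
case: x => [a b|a b|a b|a b|a|a]; try exact: EqvRefl.
  exact: sphi_xdef.
exact: sphi_xVdef.
Qed.

Definition web_functor : smfunctor (Web' q) (Web q) :=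
  subst_functor phi_typed (fun t u h _ _ _ => phi_rel h).
Definition web_functorV : smfunctor (Web q) (Web' q) :=
  subst_functor psi_typed (fun t u h _ _ _ => psi_rel h).

Lemma web_functor_mor t (ht : wt t) u (hu : wt u) : eqv rel (sphi t) u ->
  heq (fmap web_functor (mor rel' t ht)) (mor rel u hu).
Proof. exact: subst_functor_mor. Qed.

Lemma web_functor_gen x y : eqv rel (phi x) (gen k id y) ->
  heq (fmap web_functor (gen_mor rel' x)) (gen_mor rel y).
Proof. exact: (@web_functor_mor (gen k dthk' x) isT (gen k id y) isT). Qed.

Lemma web_functor_iso : is_smiso web_functor.
Proof.
exists web_functorV; split=> // a b.
- elim/clsP=> t ht; have /and3P[w _ _] := ht.
  rewrite -[fmap web_functor _]/(subst_map phi_typed rel (cls rel' ht)) subst_mapE; last first.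
    by move=> ? ? h _ _ _; exact: phi_rel.
  rewrite -[fmap _ _]/(subst_map psi_typed rel' (cls rel (subst_typed phi_typed ht)))
    subst_mapE; last first.
    by move=> ? ? h _ _ _; exact: psi_rel.
  exact: (heq_cls _ _ (subst_substE phi_typed psi_typed spsi_phi w)).
- elim/clsP=> t ht; have /and3P[w _ _] := ht.
  rewrite -[fmap web_functorV _]/(subst_map psi_typed rel' (cls rel ht)) subst_mapE; last first.
    by move=> ? ? h _ _ _; exact: psi_rel.
  rewrite -[fmap _ _]/(subst_map phi_typed rel (cls rel' (subst_typed psi_typed ht)))
    subst_mapE; last first.
    by move=> ? ? h _ _ _; exact: phi_rel.
  exact: (heq_cls _ _ (subst_substE psi_typed phi_typed sphi_psi w)).
Qed.
End Iso.

(** Quantum integers do not vanish when q is neither 0 nor a root of unity. *)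
Lemma qint_generic (k : fieldType) (q : k) n :
  q != 0 -> (forall p, q ^+ p.+1 != 1) -> qint q n.+1 != 0.
Proof.
move=> q0 hq; have H p : q ^+ p.+1 - q ^- p.+1 != 0.
  rewrite subr_eq0; apply: contra_neq (hq (p.+1 + p)%N) => e.
  by rewrite -addnS exprD {1}e mulVf // expf_neq0.
by rewrite /qint mulf_neq0 ?invr_eq0 //; exact: H 0.
Qed.

Lemma qvar_neq0 (R : realType) : qvar R != 0.
Proof. by rewrite tofrac_eq0 polyX_eq0. Qed.

Lemma qvar_expn (R : realType) p : qvar R ^+ p.+1 != 1.
Proof.
have -> : qvar R ^+ p.+1 = tofrac ('X^(p.+1) : {poly R[i]}) by rewrite tofracXn.
rewrite -tofrac1 tofrac_eq; apply/eqP => /(congr1 (fun r : {poly R[i]} => size r)).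
by rewrite size_polyXn size_poly1.
Qed.

Theorem theorem2p13 (R : realType) :
  exists F : smfunctor (Web' (qvar R)) (Web (qvar R)),
    is_smiso F /\
    (forall a : posn, F [:: a] = [:: a]) /\
    (forall a b : posn,
       heq (fmap F (web_m' (qvar R) a b)) (web_m (qvar R) a b)) /\
    (forall a b : posn,
       heq (fmap F (web_s' (qvar R) a b)) (web_s (qvar R) a b)) /\
    (forall a b : posn,
       heq (fmap F (web_c' (qvar R) a b)) (web_c (qvar R) a b)) /\
    heq (fmap F (web_x1' (qvar R))) (web_x (qvar R) (succp 0)) /\
    (forall a : posn, (2 <= val a)%N ->
       heq (fmap F (web_xdef' (qvar R) (val a))) (web_x (qvar R) a)) /\
    (forall a : posn,
       heq (fmap F (web_xVdef' (qvar R) (val a))) (web_xV (qvar R) a)).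
Proof.
have q0 n : qint (qvar R) n.+1 != 0.
  by apply: qint_generic; [exact: qvar_neq0 | exact: qvar_expn].
exists (web_functor (qvar R)); split; first exact: web_functor_iso.
split=> //; split; first by move=> a b; apply: web_functor_gen; exact: EqvRefl.
split; first by move=> a b; apply: web_functor_gen; exact: EqvRefl.
split; first by move=> a b; apply: web_functor_gen; exact: EqvRefl.
split; first by apply: web_functor_gen; exact: EqvRefl.
split=> a.
  move=> _; exact: (@web_functor_mor _ _ _ _ (gen _ id (WD a)) isT (sphi_xdef q0 a)).
exact: (@web_functor_mor _ _ _ _ (gen _ id (WDi a)) isT (sphi_xVdef q0 a)).
Qed.
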